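(* Let $\mathcal{G}$ be an ultragraph and $R$ a commutative unital ring. Let $\Theta=(\{D_t\}_{t\in\mathbb{F}},\{\theta_t\}_{t\in\mathbb{F}})$ be the algebraic partial action of $\mathbb{F}$ on $D$, and let $\hat\Delta=(\{\mathrm{Lc}(V_t,R)\}_{t\in\mathbb{F}},\{\hat\varphi_t\}_{t\in\mathbb{F}})$ be the dual of the topological partial action $\Delta=(\{V_t\}_{t\in\mathbb{F}},\{\varphi_t\}_{t\in\mathbb{F}})$ of $\mathbb{F}$ on $\mathsf{T}$. Then $\Theta$ and $\hat\Delta$ are equivalent.
   Context: Ultragraph. An ultragraph is a quadruple $\mathcal{G}=(G^0,\mathcal{G}^1,r,s)$ with $G^0,\mathcal{G}^1$ countable sets, $s:\mathcal{G}^1\to G^0$, $r:\mathcal{G}^1\to P(G^0)\setminus\{\emptyset\}$ ($P$ = power set). $\mathcal{G}^0\subseteq P(G^0)$ is the smallest family containing $\emptyset$, all $\{v\}$, all $r(e)$, and closed under finite unions and finite intersections. $\mathcal{B}$ is the smallest family containing $\mathcal{G}^0$ and closed under relative complements, finite unions and finite intersections. $G^0_s$ is the set of sinks (vertices $v$ with $s^{-1}(v)=\emptyset$). Paths. $\mathcal{L}^*$ consists of the empty word $\omega$ ($|\omega|=0$) and all words $e_1\cdots e_n$ ($n\ge1$) of edges with $s(e_{i+1})\in r(e_i)$; $\mathfrak{p}^\infty$ is the set of infinite paths. For $\alpha=e_1\cdots e_n$, $s(\alpha)=s(e_1)$, $r(\alpha)=r(e_n)$; $r(\omega)=G^0$.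 $\alpha_{1,n}$ is the beginning of $\alpha$ of length $n$. $\mathcal{B}_\alpha=\{A\in\mathcal{B}: A\subseteq r(\alpha)\}$. For $A\in\mathcal{B}$: $r(A,\omega)=A$; for $|\alpha|\ge1$, $r(A,\alpha)=r(\alpha)$ if $s(\alpha)\in A$ and $\emptyset$ otherwise. Tight spectrum. A filter in a poset with least element $0$ is a nonempty up-closed, down-directed subset not containing $0$; an ultrafilter is a maximal filter. $E(S)=\{(\alpha,A,\alpha):\alpha\in\mathcal{L}^*,\ \emptyset\ne A\in\mathcal{B}_\alpha\}\cup\{0\}$ is a meet semilattice with product $(\alpha,A,\alpha)(\beta,B,\beta)=(\beta,r(A,\gamma)\cap B,\beta)$ if $\beta=\alpha\gamma$ and $r(A,\gamma)\cap B\neq\emptyset$, symmetrically if $\alpha=\beta\gamma$, and $0$ otherwise; $p\le q$ iff $pq=p$. Filters in $E(S)$ carry the topology of pointwise convergence of their characteristic functions; $\mathsf{T}$ (tight filters) is the closure, in the space of all filters, of the set of ultrafilters, with the subspace topology. For $e\in E(S)$, $V_e=\{\xi\in\mathsf{T}:e\in\xi\}$. Each filter $\xi$ in $E(S)$ has an associated word $\alpha\in\mathcal{L}^*\cup\mathfrak{p}^\infty$: the words occurring in nonzero elements of $\xi$ are exactly the finite beginnings of $\alpha$; $\xi_n=\{A\in\mathcal{B}:(\alpha_{1,n},A,\alpha_{1,n})\in\xi\}$. For each infinite path there is exactly one filter in $\mathsf{T}$ with it as associated word; a filter with finite word $\alpha$ is determined by the pair $(\alpha,\xi_{|\alpha|})$.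 Topological partial action $\Delta$. $\mathbb{F}$ is the free group on $\mathcal{G}^1$, with identity $\omega$. $V_\omega=\mathsf{T}$, $\varphi_\omega=\mathrm{id}$. If $t\neq\omega$ has reduced form $t=\alpha\beta^{-1}$ with $\alpha,\beta\in\mathcal{L}^*$ and $r(\alpha)\cap r(\beta)\neq\emptyset$, then $V_t=V_{(\alpha,\,r(\alpha)\cap r(\beta),\,\alpha)}$ and $\varphi_t:V_{t^{-1}}\to V_t$ replaces the beginning $\beta$ by $\alpha$: if $\xi$ has infinite word $\beta\gamma$, $\varphi_t(\xi)$ is the tight filter with word $\alpha\gamma$; if $\xi$ has finite word $\beta\gamma$ with $|\gamma|\ge1$, $\varphi_t(\xi)$ is given by the pair $(\alpha\gamma,\xi_{|\beta\gamma|})$; if $\xi$ has word $\beta$, $\varphi_t(\xi)$ is given by $(\alpha,\{A\cap r(\alpha): A\in\mathcal{B},\ A\supseteq C\text{ for some }C\in\xi_{|\beta|}\})$. For all other $t$, $V_t=\emptyset$. Dual action. For a Hausdorff space $Z$, $\mathrm{Lc}(Z,R)$ is the $R$-algebra of locally constant compactly supported functions $Z\to R$; $\mathrm{Lc}(V_t,R)$ is viewed as an ideal of $\mathrm{Lc}(\mathsf{T},R)$ by extension by zero. $\hat\varphi_t:\mathrm{Lc}(V_{t^{-1}},R)\to\mathrm{Lc}(V_t,R)$, $\hat\varphi_t(f)=f\circ\varphi_{t^{-1}}$. Algebraic partial action $\Theta$. Let $Y=\mathfrak{p}^\infty\cup\{(\alpha,v):\alpha\in\mathcal{L}^*,\ v\in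 G^0_s\cap r(\alpha)\}$, where $|(\alpha,v)|=|\alpha|$. For $e=(\alpha,A,\alpha)\in E(S)\setminus\{0\}$, $Y_e=\{y\in Y:|y|>|\alpha|,\ y_{1,|\alpha|}=\alpha,\ s(y_{|\alpha|+1})\in A\}\cup\{(\alpha,v):v\in A\cap G^0_s\}$; $Y_0=\emptyset$. $D$ is the $R$-subalgebra of the algebra of functions $Y\to R$ (pointwise operations) spanned by $\{1_{Y_e}:e\in E(S)\}$. Put $Y_\omega=Y$; $Y_t=Y_{(\alpha,\,r(\alpha)\cap r(\beta),\,\alpha)}$ for $t\ne\omega$ with reduced form $\alpha\beta^{-1}$, $\alpha,\beta\in\mathcal{L}^*$, $r(\alpha)\cap r(\beta)\neq\emptyset$; and $Y_t=\emptyset$ otherwise. Let $h_t:Y_{t^{-1}}\to Y_t$ be the bijection replacing the beginning $\beta$ by $\alpha$ ($\beta\gamma\mapsto\alpha\gamma$ on infinite paths, $(\beta\gamma,v)\mapsto(\alpha\gamma,v)$ on finite elements; $h_\omega=\mathrm{id}$). $D_t$ is the ideal of $D$ spanned by $\{1_{Y_t}1_{Y_e}:e\in E(S)\}$, and $\theta_t:D_{t^{-1}}\to D_t$, $\theta_t(f)=f\circ h_{t^{-1}}$ (extended by zero outside $Y_t$). Equivalence. $\Theta$ and $\hat\Delta$ are equivalent if there is an $R$-algebra isomorphism $\psi:\mathrm{Lc}(\mathsf{T},R)\to D$ with $\psi(\mathrm{Lc}(V_t,R))=D_t$ and $\psi\circ\hat\varphi_t=\theta_t\circ\psi$ on $\mathrm{Lc}(V_{t^{-1}},R)$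 for all $t\in\mathbb{F}$. *)

(* Defs.v *)
From HB Require Import structures.
From mathcomp Require Import all_boot all_algebra.
From mathcomp Require Import boolp classical_sets functions.
From mathcomp Require Import topology numfun.

Set Implicit Arguments.
Unset Strict Implicit.
Unset Printing Implicit Defensive.

Import GRing.Theory.

Local Open Scope classical_set_scope.
Local Open Scope ring_scope.

(* The free group on X, realized as the reduced words in the letters (true, x),
   standing for x, and (false, x), standing for x^-1. *)
Section FreeGroup.
Context (X : countType).

Definition letter_inv (a : bool * X) : bool * X := (~~ a.1, a.2).

Definition reduced (w : seq (bool * X)) : bool :=
  sorted (fun a b => b != letter_inv a) w.

Record free_group : Type :=
  FreeGroup { fg_word :> seq (bool * X) ; fg_reduced : reduced fg_word }.

HB.instance Definition _ := [isSub for fg_word].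
HB.instance Definition _ := [Countable of free_group by <:].

Definition reduced_cons (a : bool * X) (w : seq (bool * X)) :=
  if w is b :: w' then if b == letter_inv a then w' else a :: w else [:: a].

Definition word_mul (u v : seq (bool * X)) := foldr reduced_cons v u.
Definition word_inv (u : seq (bool * X)) := rev (map letter_inv u).

Lemma letter_invK : involutive letter_inv.
Proof. by case=> b x; rewrite /letter_inv /= negbK. Qed.

Lemma reduced_behead a w : reduced (a :: w) -> reduced w.
Proof. exact: path_sorted. Qed.

Lemma reduced_consP a w : reduced w -> reduced (reduced_cons a w).
Proof.
case: w => [//|b w] rw /=; case: ifPn => [_|ba]; first exact: reduced_behead rw.
by rewrite /reduced /= ba.
Qed.

Lemma reduced_consK a w :
  reduced w -> reduced_cons (letter_inv a) (reduced_cons a w) = w.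
Proof.
case: w => [|b w] /=; first by rewrite letter_invK eqxx.
case: ifPn => [/eqP -> |_ _]; last by rewrite /= letter_invK eqxx.
by case: w => [//|c w] /=; rewrite /reduced /= => /andP[/negPf ->].
Qed.

Lemma reduced_consVK a w :
  reduced w -> reduced_cons a (reduced_cons (letter_inv a) w) = w.
Proof. by move=> rw; rewrite -{1}[a]letter_invK reduced_consK. Qed.

Lemma word_mulP u v : reduced v -> reduced (word_mul u v).
Proof. by move=> rv; elim: u => //= a u IH; exact: reduced_consP. Qed.

Lemma word_invP u : reduced u -> reduced (word_inv u).
Proof.
rewrite /reduced /word_inv rev_sorted sorted_map; apply: sub_sorted => a b /=.
by apply: contra => /eqP ->; rewrite letter_invK.
Qed.

Lemma word_mul_reduced_cons a u w :
  reduced u -> reduced w ->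
  word_mul (reduced_cons a u) w = reduced_cons a (word_mul u w).
Proof.
case: u => [//|b u] /= ru rw; case: ifPn => [/eqP -> |//].
by rewrite reduced_consVK // word_mulP.
Qed.

Lemma word_mulA u v w : reduced v -> reduced w ->
  word_mul u (word_mul v w) = word_mul (word_mul u v) w.
Proof.
move=> rv rw; elim: u => //= a u ->.
by rewrite word_mul_reduced_cons // word_mulP.
Qed.

Lemma word_mulw0 u : reduced u -> word_mul u [::] = u.
Proof.
elim: u => //= a u IH rau; rewrite IH ?(reduced_behead rau)//.
by case: u rau {IH} => //= b u; rewrite /reduced /= => /andP[/negPf ->].
Qed.

Lemma word_mulVw u : reduced u -> word_mul (word_inv u) u = [::].
Proof.
elim: u => //= a u IH rau; rewrite /word_inv /= rev_cons /word_mul.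
by rewrite foldr_rcons /= letter_invK eqxx; exact/IH/reduced_behead/rau.
Qed.

Lemma word_invK : involutive word_inv.
Proof. by move=> u; rewrite /word_inv map_rev revK mapK //; exact: letter_invK. Qed.

Definition fg_one : free_group := @FreeGroup [::] isT.
Definition fg_mul (s t : free_group) : free_group :=
  FreeGroup (word_mulP s (fg_reduced t)).
Definition fg_inv (t : free_group) : free_group :=
  FreeGroup (word_invP (fg_reduced t)).

Lemma fg_mulA : associative fg_mul.
Proof. by move=> s t u; apply: val_inj; rewrite /= word_mulA ?fg_reduced. Qed.

Lemma fg_mul1g : left_id fg_one fg_mul.
Proof. by move=> t; apply: val_inj. Qed.

Lemma fg_mulg1 : right_id fg_one fg_mul.
Proof. by move=> t; apply: val_inj; rewrite /= word_mulw0 ?fg_reduced. Qed.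

Lemma fg_mulVg : left_inverse fg_one fg_inv fg_mul.
Proof. by move=> t; apply: val_inj; rewrite /= word_mulVw ?fg_reduced. Qed.

Lemma fg_mulgV : right_inverse fg_one fg_inv fg_mul.
Proof.
move=> t; apply: val_inj; rewrite /= -{1}[fg_word t]word_invK.
by rewrite word_mulVw // word_invP ?fg_reduced.
Qed.

HB.instance Definition _ := isGroup.Build free_group
  fg_mulA fg_mul1g fg_mulg1 fg_mulVg fg_mulgV.

End FreeGroup.

(* Since the words of free_group are reduced, this says that alpha beta^-1 is
   the reduced form of t. *)
Definition reduced_form (X : countType) (t : free_group X) (alpha beta : seq X) :=
  fg_word t = [seq (true, e) | e <- alpha] ++ [seq (false, e) | e <- rev beta].

Section PosetFilters.
Context (T : Type) (P : set T) (le : T -> T -> Prop) (zero : T).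

Definition is_pfilter (xi : set T) : Prop :=
  [/\ xi `<=` P, xi !=set0, ~ xi zero,
      forall p q, xi p -> P q -> le p q -> xi q &
      forall p q, xi p -> xi q -> exists r, [/\ xi r, le r p & le r q]].

Definition is_pultrafilter (xi : set T) : Prop :=
  is_pfilter xi /\ forall eta, is_pfilter eta -> xi `<=` eta -> eta = xi.

End PosetFilters.

(* Subsets of T, with the topology of pointwise convergence of their
   characteristic functions. Subsets of a fixed P `<=` T have characteristic
   functions that vanish off P, so that T in place of P does not change the
   topology. *)
Definition set_ptws (T : Type) : Type :=
  initial_topology
    ((fun (A : set T) (x : T) => x \in A) : set T -> {ptws T -> bool}).
HB.instance Definition _ (T : Type) := Topological.on (set_ptws T).

Definition lin_span (R : comPzRingType) (X : Type) (S : set (X -> R)) :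
    set (X -> R) :=
  [set f | exists n (c : 'I_n -> R) (g : 'I_n -> X -> R),
     (forall i, S (g i)) /\ f = (fun x => \sum_(i < n) c i * g i x)].

Definition Lc (R : comPzRingType) (Z : topologicalType) : set (Z -> R) :=
  [set f : Z -> R | (forall z, \forall w \near z, f w = f z) /\
           compact (closure [set z | f z != 0])].
Arguments Lc : clear implicits.

(* Lc(U, R) for U a subset of Z with the subspace topology, viewed inside the
   functions on Z by extension by zero. *)
Definition Lc_ext0 (R : comPzRingType) (Z : topologicalType) (U : set Z) :
    set (Z -> R) :=
  [set f : Z -> R | Lc R (set_type U) (fun u => f (set_val u)) /\
           forall z, ~ U z -> f z = 0].
Arguments Lc_ext0 : clear implicits.

(* The data of a partial action by partially defined bijections: the map pa_map
   t is only meaningful from pa_dom t^-1 to pa_dom t. *)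
Record partial_action (F : groupType) (Z : Type) := PartialAction {
  pa_dom : F -> set Z ;
  pa_map : F -> Z -> Z
}.

(* The data of a partial action on an algebra of R-valued functions: the map
   apa_map t is only meaningful from apa_ideal t^-1 to apa_ideal t. *)
Record alg_partial_action (R : comPzRingType) (F : groupType) (Z : Type) :=
  AlgPartialAction {
    apa_alg : set (Z -> R) ;
    apa_ideal : F -> set (Z -> R) ;
    apa_map : F -> (Z -> R) -> (Z -> R)
  }.

Section Dual.
Context (R : comPzRingType) (F : groupType) (Z : Type).
Variable (Delta : partial_action F Z).

Definition pullback (t : F) (f : Z -> R) : Z -> R :=
  fun z => if z \in pa_dom Delta t then f (pa_map Delta t^-1%g z) else 0.

End Dual.

Definition dual_partial_action (R : comPzRingType) (F : groupType)
    (Z : topologicalType) (Delta : partial_action F Z) :=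
  AlgPartialAction (Lc R Z) (fun t => Lc_ext0 R Z (pa_dom Delta t))
                   (pullback Delta).
Arguments dual_partial_action : clear implicits.
Arguments dual_partial_action R {F Z}.

(* psi is a bijection of A onto B respecting the (possibly non-unital)
   R-algebra structures. *)
Definition alg_isomorphism (R : comPzRingType) (X Z : Type)
    (A : set (X -> R)) (B : set (Z -> R)) (psi : (X -> R) -> (Z -> R)) : Prop :=
  [/\ set_bij A B psi,
      forall f g, A f -> A g -> psi (f \+ g) = psi f \+ psi g,
      forall f g, A f -> A g -> psi (f \* g) = psi f \* psi g &
      forall c f, A f -> psi (c \*o f) = c \*o psi f].

Definition apa_equivalent (R : comPzRingType) (F : groupType) (X Z : Type)
    (Theta : alg_partial_action R F X) (Lambda : alg_partial_action R F Z) :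
    Prop :=
  exists psi : (Z -> R) -> (X -> R),
    alg_isomorphism (apa_alg Lambda) (apa_alg Theta) psi /\
    forall t : F,
      psi @` apa_ideal Lambda t = apa_ideal Theta t /\
      forall f, apa_ideal Lambda t^-1%g f ->
        psi (apa_map Lambda t f) = apa_map Theta t (psi f).

Record ultragraph := Ultragraph {
  vertex : countType ;
  edge : countType ;
  edge_range : edge -> set vertex ;
  edge_source : edge -> vertex ;
  edge_range_neq0 : forall e, edge_range e !=set0
}.
Arguments edge_range {u}.
Arguments edge_source {u}.

Inductive pword (X : Type) : Type := Fin of seq X | Inf of (nat -> X).

Definition cat_inf (X : Type) (alpha : seq X) (gamma : nat -> X) : nat -> X :=
  fun n => nth (gamma (n - size alpha)%N) alpha n.

Definition cat_pword (X : Type) (alpha : seq X) (w : pword X) : pword X :=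
  match w with
  | Fin gamma => Fin (alpha ++ gamma)
  | Inf gamma => Inf (cat_inf alpha gamma)
  end.

Definition beginning (X : eqType) (u : seq X) (w : pword X) : Prop :=
  match w with
  | Fin alpha => prefix u alpha
  | Inf gamma => u = mkseq gamma (size u)
  end.

(* Boundary paths: infinite paths, and finite paths ending in a sink. *)
Inductive ypath (G : ultragraph) : Type :=
  | YInf of (nat -> edge G)
  | YFin of seq (edge G) & vertex G.
HB.instance Definition _ (G : ultragraph) := gen_eqMixin (ypath G).
HB.instance Definition _ (G : ultragraph) := gen_choiceMixin (ypath G).

Section Ultragraph.
Context (G : ultragraph).
Implicit Types (alpha beta gamma : seq (edge G)) (A B C : set (vertex G)).

Inductive G0_family : set (vertex G) -> Prop :=
  | G0_set0 : G0_family set0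
  | G0_set1 v : G0_family [set v]
  | G0_range e : G0_family (edge_range e)
  | G0_setU A B : G0_family A -> G0_family B -> G0_family (A `|` B)
  | G0_setI A B : G0_family A -> G0_family B -> G0_family (A `&` B).

Inductive B_family : set (vertex G) -> Prop :=
  | B_G0 A : G0_family A -> B_family A
  | B_setD A B : B_family A -> B_family B -> B_family (A `\` B)
  | B_setU A B : B_family A -> B_family B -> B_family (A `|` B)
  | B_setI A B : B_family A -> B_family B -> B_family (A `&` B).

Definition sink (v : vertex G) : Prop := forall e : edge G, edge_source e <> v.

Definition is_path alpha : bool :=
  sorted (fun e f : edge G => edge_source f \in edge_range e) alpha.

Definition is_inf_path (p : nat -> edge G) : Prop :=
  forall n, edge_range (p n) (edge_source (p n.+1)).

Definition path_range alpha : set (vertex G) :=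
  if alpha is e :: alpha' then edge_range (last e alpha') else setT.

Definition B_at alpha : set (set (vertex G)) :=
  [set A | B_family A /\ A `<=` path_range alpha].

Definition rel_range A alpha : set (vertex G) :=
  if alpha is e :: _ then if edge_source e \in A then path_range alpha else set0
  else A.

(* None stands for 0 and Some (alpha, A) for (alpha, A, alpha). *)
Notation triple := (option (seq (edge G) * set (vertex G))).

Definition ES : set triple :=
  [set p | match p with
           | None => True
           | Some (alpha, A) => [/\ is_path alpha, A !=set0 & B_at alpha A]
           end].

Definition ES_mul (p q : triple) : triple :=
  match p, q with
  | Some (alpha, A), Some (beta, B) =>
      if prefix alpha beta then
        let C := rel_range A (drop (size alpha) beta) `&` B in
        if C != set0 then Some (beta, C) else None
      else if prefix beta alpha then
        let C := rel_range B (drop (size beta) alpha) `&` A in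
        if C != set0 then Some (alpha, C) else None
      else None
  | _, _ => None
  end.

Definition ES_le (p q : triple) : Prop := ES_mul p q = p.

Definition ES_filters : set (set_ptws triple) :=
  [set xi | is_pfilter ES ES_le None xi].

Definition filter_space : topologicalType := set_type ES_filters.

Definition tight : set filter_space :=
  closure [set xi : filter_space | is_pultrafilter ES ES_le None (set_val xi)].

Definition tight_space : topologicalType := set_type tight.

Definition filter_of (xi : tight_space) : set triple :=
  set_val (set_val xi : filter_space).

Definition V_elt (e : triple) : set tight_space := [set xi | filter_of xi e].

Definition has_word (xi : set triple) (w : pword (edge G)) : Prop :=
  forall u, (exists A, xi (Some (u, A))) <-> beginning u w.

(* If alpha is the beginning of length n of the word of xi, this is xi_n. *)
Definition level (xi : set triple) alpha : set (set (vertex G)) :=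
  [set A | B_family A /\ xi (Some (alpha, A))].

Definition admissible (t : free_group (edge G)) alpha beta : Prop :=
  [/\ t != 1%g, reduced_form t alpha beta, is_path alpha, is_path beta &
      path_range alpha `&` path_range beta !=set0].

Definition V_dom (t : free_group (edge G)) : set tight_space :=
  [set xi | t = 1%g \/ exists alpha beta, admissible t alpha beta /\
     V_elt (Some (alpha, path_range alpha `&` path_range beta)) xi].

Definition phi_graph (t : free_group (edge G)) (xi eta : tight_space) : Prop :=
  (t = 1%g /\ eta = xi) \/
  exists alpha beta, admissible t alpha beta /\
    let x := filter_of xi in
    let y := filter_of eta in
    [\/ exists gamma : nat -> edge G,
          has_word x (Inf (cat_inf beta gamma)) /\
          has_word y (Inf (cat_inf alpha gamma)),
        exists gamma, [/\ (0 < size gamma)%N,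
          has_word x (Fin (beta ++ gamma)),
          has_word y (Fin (alpha ++ gamma)) &
          level y (alpha ++ gamma) = level x (beta ++ gamma)] |
        [/\ has_word x (Fin beta), has_word y (Fin alpha) &
          level y alpha =
          [set A `&` path_range alpha | A in
             [set A | B_family A /\ exists2 C, level x beta C & C `<=` A]]]].

(* The image of xi is the tight filter eta with phi_graph t xi eta; the value
   is irrelevant when xi is not in V_dom t^-1. *)
Definition phi_map (t : free_group (edge G)) (xi : tight_space) : tight_space :=
  xget xi [set eta | phi_graph t xi eta].

Definition Delta : partial_action (free_group (edge G)) tight_space :=
  PartialAction V_dom phi_map.

Definition Yset : set (ypath G) :=
  [set y | match y with
           | YInf p => is_inf_path p
           | YFin alpha v => [/\ is_path alpha, sink v & path_range alpha v]
           end].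

Definition Y : choiceType := set_type Yset.

Definition ypath_word (y : ypath G) : pword (edge G) :=
  match y with YInf p => Inf p | YFin alpha _ => Fin alpha end.

Definition Y_elt (p : triple) : set Y :=
  [set y | match p with
           | None => False
           | Some (alpha, A) =>
               (exists2 e, beginning (rcons alpha e) (ypath_word (set_val y)) &
                           A (edge_source e)) \/
               (exists2 v, set_val y = YFin alpha v & A v /\ sink v)
           end].

Definition Y_dom (t : free_group (edge G)) : set Y :=
  [set y | t = 1%g \/ exists alpha beta, admissible t alpha beta /\
     Y_elt (Some (alpha, path_range alpha `&` path_range beta)) y].

Definition h_graph (t : free_group (edge G)) (y z : Y) : Prop :=
  (t = 1%g /\ z = y) \/
  exists alpha beta, admissible t alpha beta /\
    ((exists gamma : nat -> edge G,
        set_val y = YInf (cat_inf beta gamma) /\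
        set_val z = YInf (cat_inf alpha gamma)) \/
     (exists gamma v,
        set_val y = YFin (beta ++ gamma) v /\
        set_val z = YFin (alpha ++ gamma) v)).

(* The value is irrelevant when y is not in Y_dom t^-1. *)
Definition h_map (t : free_group (edge G)) (y : Y) : Y :=
  xget y [set z | h_graph t y z].

Context (R : comPzRingType).

Definition D_alg : set (Y -> R) :=
  lin_span [set \1_(Y_elt e) | e in ES].

Definition D_ideal (t : free_group (edge G)) : set (Y -> R) :=
  lin_span [set \1_(Y_dom t) \* \1_(Y_elt e) | e in ES].

Definition Theta : alg_partial_action R (free_group (edge G)) Y :=
  AlgPartialAction D_alg D_ideal (pullback (PartialAction Y_dom h_map)).

End Ultragraph.

(* Main.v *)
Require Import Defs.
From mathcomp Require Import all_boot all_algebra.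
From mathcomp Require Import boolp classical_sets functions.
From mathcomp Require Import topology numfun.

Set Implicit Arguments.
Unset Strict Implicit.
Unset Printing Implicit Defensive.

Import GRing.Theory.
Local Open Scope classical_set_scope.

(** Every boundary path [y] defines a filter, made of the elements [e] such that
[y] lies in [Y_elt e]. This filter is maximal, hence tight, which gives a map
[boundary_point] from [Y G] to the tight spectrum under which the preimage of
[V_elt e] is [Y_elt e]. The isomorphism of the two partial actions is the
restriction of functions along this map.

Restriction respects the pointwise operations. It is injective on locally
constant functions because boundary paths are dense in the tight spectrum
([boundary_point_dense]): an ultrafilter contains an element disjoint from any
element that it misses, so that finitely many membership conditions satisfied by
an ultrafilter are satisfied on a whole nonzero cylinder, and a nonzero cylinder
contains a boundary path. Its image is the algebra spanned by the indicators of
the sets [Y_elt e] because locally constant functions with compact support are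
spanned by the indicators of the sets [V_elt e] ([Lc_tightE]): these sets are
compact open, closed under intersection, and with their complements they
generate the topology.

The domain of a group element is, on both sides, either everything or the set
given by one and the same element of the semilattice ([V_dom_Y_dom]), so that
the ideals correspond. Equivariance is an equality of functions on
boundary paths, so it only needs the two partial bijections to agree there
([phi_map_boundary]). They do, since a filter is determined by its word, together with
its level at the end of the word when the word is finite ([filter_word_inj]).

Computations in the semilattice [ES] are done on cylinders, in a set of paths
large enough to turn products into intersections and to separate elements
([cylinder_mul], [cylinder_inj]). *)

(** * Cylinders and the semilattice of an ultragraph *)

Section Cylinders.
Context (G : ultragraph).
Implicit Types (alpha beta gamma u : seq (edge G)) (A B : set (vertex G)).
Implicit Types (y : ypath G) (w : pword (edge G)) (v : vertex G).
Local Notation triple := (option (seq (edge G) * set (vertex G))).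

Lemma beginning_prefix u u' w :
  prefix u u' -> beginning u' w -> beginning u w.
Proof.
case: w => [alpha|p] /=; first exact: prefix_trans.
move=> /prefixP[s ->]; rewrite size_cat => /(congr1 (take (size u))).
rewrite take_size_cat// => {1}->; rewrite /mkseq -map_take take_iota.
by rewrite (minn_idPl (leq_addr _ _)).
Qed.

Lemma beginning_total u u' w :
  beginning u w -> beginning u' w -> prefix u u' \/ prefix u' u.
Proof.
wlog le : u u' / size u <= size u'.
  move=> H bu bu'; case: (leqP (size u) (size u')) => [le|/ltnW le].
    exact: H.
  by case: (H _ _ le bu' bu); [right|left].
case: w => [alpha|p] /=.
  move=> /prefixP[s ->] /prefixP[s' es]; left; apply/prefixP.
  exists (drop (size u) u'); apply/eqP.
  rewrite -[X in X == _](cat_take_drop (size u)).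
  rewrite eqseq_cat ?eqxx ?andbT ?size_takel//; apply/eqP.
  move: (congr1 (take (size u)) es); rewrite take_size_cat// takel_cat//.
move=> bu bu'; left; apply/prefixP; exists (drop (size u) u').
rewrite -{1}(cat_take_drop (size u) u'); congr (_ ++ _).
by rewrite bu' /mkseq -map_take take_iota (minn_idPl le) {2}bu.
Qed.

Lemma beginning_mkseq (p : nat -> edge G) n : beginning (mkseq p n) (Inf p).
Proof. by rewrite /beginning size_mkseq. Qed.

Lemma beginning_inj w w' :
  (forall u, beginning u w <-> beginning u w') -> w = w'.
Proof.
case: w => [a|p]; case: w' => [b|q] H.
- have /H/prefixP[s eb] : beginning a (Fin a) by exact: prefix_refl.
  have /H/prefixP[s' ea] : beginning b (Fin b) by exact: prefix_refl.
  have := congr1 size ea; rewrite eb !size_cat => /eqP.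
  rewrite -addnA -{1}[size a]addn0 eqn_add2l eq_sym addn_eq0 => /andP[/nilP s0 _].
  by rewrite s0 cats0.
- have /H/size_prefix := beginning_mkseq q (size a).+1.
  by rewrite size_mkseq ltnn.
- have /H/size_prefix := beginning_mkseq p (size b).+1.
  by rewrite size_mkseq ltnn.
- congr Inf; apply/funext => n.
  have /H := beginning_mkseq p n.+1; rewrite /beginning size_mkseq.
  move=> /(congr1 (fun s => nth (p n) s n)).
  by rewrite !nth_mkseq.
Qed.

Lemma beginning_next u w :
  beginning u w -> w = Fin u \/ exists e, beginning (rcons u e) w.
Proof.
case: w => [alpha|p] /=.
  move=> /prefixP[[|e s] ->]; first by left; rewrite cats0.
  by right; exists e; rewrite -cat_rcons prefix_prefix.
move=> ->; right; exists (p (size u)).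
by rewrite size_rcons size_mkseq mkseqS.
Qed.

(** The vertex that a path tests against [A] to belong to the cylinder of
[(alpha, A)], where [n] is the length of [alpha]: taking the final vertex as the
default value treats alike the paths that go on after [alpha] and those that
stop there. *)
Definition vertex_at y n : vertex G :=
  match y with
  | YInf p => edge_source (p n)
  | YFin alpha v => nth v (map edge_source alpha) n
  end.

Lemma vertex_at_beginning u e y :
  beginning (rcons u e) (ypath_word y) -> vertex_at y (size u) = edge_source e.
Proof.
case: y => [p|alpha v] /=.
  rewrite size_rcons mkseqS => /eqP; rewrite eqseq_rcons => /andP[_ /eqP ->//].
move=> /prefixP[s ->]; rewrite map_cat map_rcons nth_cat size_rcons size_map ltnSn.
by rewrite nth_rcons size_map ltnn eqxx.
Qed.

Lemma vertex_at_end u v : vertex_at (YFin u v) (size u) = v.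
Proof. by rewrite /= nth_default// size_map. Qed.

(** The set [Y_elt e], extended to finite paths whose final vertex need not be
a sink. The additional points make an element of [ES] determined by its cylinder:
with sinks only, a vertex [v] emitting a single edge [g] would give the same set
as [g] with its full range. *)
Definition cylinder (e : triple) : set (ypath G) :=
  [set y | if e is Some (alpha, A) then
    beginning alpha (ypath_word y) /\ A (vertex_at y (size alpha)) else False].

Lemma Y_eltE (e : triple) (y : Y G) : Y_elt e y <-> cylinder e (set_val y).
Proof.
case: e => [[alpha A]|//]; rewrite /Y_elt /=.
have Yy : Yset (set_val y) := set_valP y; move: (set_val y) Yy => z Yz.
split=> [[[e ae Ae]|[v -> [Av sv]]]|[az Az]].
- split; first exact: beginning_prefix (prefix_rcons _ _) ae.
  by rewrite (vertex_at_beginning ae).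
- by rewrite vertex_at_end; split=> //; exact: prefix_refl.
- case: (beginning_next az) => [|[e ae]]; last first.
    by left; exists e => //; rewrite -(vertex_at_beginning ae).
  case: z az Az Yz => [//|u v] _ Av [_ sv _] [ua].
  by right; exists v; [rewrite ua|split=> //; rewrite ua vertex_at_end in Av].
Qed.

Lemma B_family0 : B_family (@set0 (vertex G)).
Proof. exact/B_G0/G0_set0. Qed.

Lemma B_family1 v : B_family [set v].
Proof. exact/B_G0/G0_set1. Qed.

Lemma path_range_cat alpha beta :
  beta != [::] -> path_range (alpha ++ beta) = path_range beta.
Proof.
case: alpha => [//|a alpha]; case: beta => [//|b beta] _ /=.
by rewrite last_cat.
Qed.

Lemma ES_mulC (e f : triple) : ES_mul e f = ES_mul f e.
Proof.
case: e => [[a A]|]; case: f => [[b B]|] //=.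
case: (boolP (prefix a b)) => // ab; case: (boolP (prefix b a)) => // ba.
have {ba} := size_prefix ba; move: ab => /prefixP[s ->].
rewrite size_cat -{2}[size a]addn0 leq_add2l leqn0 => /nilP ->.
by rewrite cats0 addn0 drop_size /= setIC.
Qed.

(** When [alpha] is a beginning of [beta], multiplying by [(alpha, A)] acts on
[B] as an all-or-nothing condition on the next edge, because [B] already lies in
the range of [beta]. *)
Lemma rel_rangeI A B alpha beta : prefix alpha beta ->
    B `<=` path_range beta ->
  rel_range A (drop (size alpha) beta) `&` B =
    [set v | B v /\ A (vertex_at (YFin beta v) (size alpha))].
Proof.
move=> /prefixP[[|g s] ->] Br.
  rewrite cats0 drop_size /= setIC.
  by rewrite predeqE => v /=; rewrite nth_default ?size_map.
rewrite drop_size_cat// /rel_range predeqE => v /=.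
rewrite map_cat nth_cat size_map ltnn subnn /=.
split=> [[]|[Bv /mem_set ->]]; last first.
  by split=> //; move: (Br _ Bv); rewrite path_range_cat.
by case: ifPn => // /set_mem Ag _ Bv.
Qed.

(** When neither word extends the other, both the product and the
intersection are empty; otherwise the longer word already lies in the cylinder of
the shorter one, up to the condition on the next edge. *)
Lemma cylinder_mul (e f : triple) : ES e -> ES f ->
  cylinder (ES_mul e f) = cylinder e `&` cylinder f.
Proof.
have noP alpha beta : prefix alpha beta || prefix beta alpha = false ->
    forall A B y, ~ (cylinder (Some (alpha, A)) `&` cylinder (Some (beta, B))) y.
  move=> ab A B y [[/= ay _] [by_ _]].
  by case: (beginning_total ay by_) => H; rewrite H ?orbT in ab.
have preP alpha beta A B : prefix alpha beta -> B `<=` path_range beta ->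
    cylinder (ES_mul (Some (alpha, A)) (Some (beta, B))) =
    cylinder (Some (alpha, A)) `&` cylinder (Some (beta, B)).
  move=> ab Br; rewrite /= ab rel_rangeI//.
  set C := [set v | _].
  have H y : beginning beta (ypath_word y) ->
      vertex_at (YFin beta (vertex_at y (size beta))) (size alpha) =
      vertex_at y (size alpha).
    move: ab => /prefixP[[|g s] ->] bb; first by rewrite cats0 vertex_at_end.
    rewrite (@vertex_at_beginning alpha g y); last first.
      by apply: beginning_prefix bb; rewrite -cat_rcons prefix_prefix.
    by rewrite /= map_cat nth_cat size_map ltnn subnn.
  have CE y : beginning beta (ypath_word y) -> C (vertex_at y (size beta)) <->
      B (vertex_at y (size beta)) /\ A (vertex_at y (size alpha)).
    by move=> bb; rewrite /C /= -(H y bb).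
  rewrite predeqE => y; split.
    case: ifPn => // _ [bb] /(CE _ bb)[Bb Aa]; split=> //.
    by split=> //; exact: beginning_prefix ab bb.
  move=> [[aa Aa] [bb Bb]]; have Cy : C (vertex_at y (size beta)) by exact/CE.
  by case: ifPn => [//|/negPn/eqP C0]; move: Cy; rewrite C0.
case: e => [[a A]|]; case: f => [[b B]|] ESe ESf; last 3 first.
- by rewrite /= predeqE => y; split=> // -[].
- by rewrite /= predeqE => y; split=> // -[].
- by rewrite /= predeqE => y; split=> // -[].
case: (boolP (prefix a b)) => [ab|nab].
  by apply: preP => //; case: ESf => _ _ [].
case: (boolP (prefix b a)) => [ba|nba].
  by rewrite ES_mulC setIC; apply: preP => //; case: ESe => _ _ [].
rewrite [ES_mul _ _]/= (negPf nab) (negPf nba) predeqE => y; split=> // H.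
by have := @noP a b _ A B y H; rewrite (negPf nab) (negPf nba); apply.
Qed.

Lemma ES_mulP (e f : triple) : ES e -> ES f -> ES (ES_mul e f).
Proof.
have H alpha beta A B : ES (Some (alpha, A)) -> ES (Some (beta, B)) ->
    prefix alpha beta -> ES (ES_mul (Some (alpha, A)) (Some (beta, B))).
  move=> [pa _ [BA Aa]] [pb _ [BB Bb]] ab; rewrite /= ab.
  set C := (_ `&` _); case: ifPn => [/set0P C0|//]; split=> //.
  split; last by move=> v [_ /Bb].
  rewrite /C /rel_range; case: (drop _ _) => [|g s]; first exact: B_setI.
  case: ifP => _; last by rewrite set0I; exact: B_family0.
  apply: B_setI => //; exact/B_G0/G0_range.
case: e => [[a A]|]; case: f => [[b B]|] ESe ESf //.
case: (boolP (prefix a b)) => [ab|nab]; first exact: H.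
case: (boolP (prefix b a)) => [ba|nba]; first by rewrite ES_mulC; exact: H.
by rewrite /= (negPf nab) (negPf nba).
Qed.

Lemma cylinder_neq0 (e : triple) : ES e -> e <> None -> cylinder e !=set0.
Proof.
case: e => [[a A] [_ [v Av] _] _|//]; exists (YFin a v).
by split; [exact: prefix_refl|rewrite vertex_at_end].
Qed.

(** The shortest path in a cylinder recovers the word, and the final vertices
of the paths with exactly this word recover the set. *)
Lemma cylinder_inj (e f : triple) : ES e -> ES f -> cylinder e = cylinder f -> e = f.
Proof.
have H a A b B : ES (Some (a, A)) ->
    cylinder (Some (a, A)) `<=` cylinder (Some (b, B)) -> prefix b a.
  move=> [_ [v Av] _] /(_ (YFin a v)) [] //.
  by split; [exact: prefix_refl|rewrite vertex_at_end].
case: e => [[a A]|]; case: f => [[b B]|] ESe ESf ef //.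
- have /prefixP[s es] : prefix b a by apply: (H _ _ _ B ESe); rewrite ef.
  have /size_prefix : prefix a b by apply: (H _ _ _ A ESf); rewrite ef.
  rewrite es size_cat -{2}[size b]addn0 leq_add2l leqn0 => /nilP s0.
  move: es ef; rewrite s0 cats0 => {H ESe}-> ef; suff -> : A = B by [].
  apply/predeqP => v; move: ef; rewrite predeqE => /(_ (YFin b v)).
  rewrite /cylinder /mkset vertex_at_end => -[ef fe].
  have bb := prefix_refl b.
  by split=> [Av|Bv]; [case: ef|case: fe].
- by have [//|y] := cylinder_neq0 ESe; rewrite ef.
- by have [//|y] := cylinder_neq0 ESf; rewrite -ef.
Qed.

Lemma ES_leP (e f : triple) : ES e -> ES f ->
  ES_le e f <-> cylinder e `<=` cylinder f.
Proof.
move=> ESe ESf; rewrite /ES_le; split=> [<-|ef].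
  by rewrite cylinder_mul// => y [].
apply: cylinder_inj => //; first exact: ES_mulP.
by rewrite cylinder_mul//; exact/setIidPl.
Qed.

End Cylinders.

(** * Filters, words and boundary paths *)

Section Filters.
Context (G : ultragraph).
Implicit Types (alpha beta gamma u : seq (edge G)) (A B : set (vertex G)).
Implicit Types (y z : ypath G) (w : pword (edge G)) (v : vertex G).
Local Notation triple := (option (seq (edge G) * set (vertex G))).
Implicit Types (e f : triple) (xi eta : set triple).
Local Notation is_filter := (is_pfilter (@ES G) (@ES_le G) None).
Local Notation is_ultrafilter := (is_pultrafilter (@ES G) (@ES_le G) None).

(** With the order read as inclusion of cylinders, down-directedness amounts
to closure under products, the product being the meet. *)
Lemma is_filterP xi : is_filter xi <->
  [/\ xi `<=` @ES G, xi !=set0, ~ xi None,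
      forall e f, xi e -> ES f -> cylinder e `<=` cylinder f -> xi f &
      forall e f, xi e -> xi f -> xi (ES_mul e f)].
Proof.
split=> -[sub ne n0 up dir]; split=> //.
- move=> e f xe ESf ef; apply: (up _ _ xe ESf); apply/ES_leP => //; exact: sub.
- move=> e f xe xf; have [r [xr re rf]] := dir _ _ xe xf.
  have ESr := sub _ xr; have [ESe ESf] := conj (sub _ xe) (sub _ xf).
  apply: (up _ _ xr); first exact: ES_mulP.
  apply/ES_leP => //; first exact: ES_mulP.
  rewrite cylinder_mul// subsetI; split.
    exact/(ES_leP ESr ESe).
  exact/(ES_leP ESr ESf).
- move=> e f xe ESf ef; apply: (up _ _ xe ESf); apply/ES_leP => //; exact: sub.
- move=> e f xe xf; have [ESe ESf] := conj (sub _ xe) (sub _ xf).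
  have ESm := ES_mulP ESe ESf; exists (ES_mul e f); split; first exact: dir.
    by apply/(ES_leP ESm ESe); rewrite cylinder_mul// => y [].
  by apply/(ES_leP ESm ESf); rewrite cylinder_mul// => y [].
Qed.

Lemma filter_meet xi e f : is_filter xi -> xi e -> xi f ->
  cylinder e `&` cylinder f !=set0.
Proof.
move=> /is_filterP[sub ne n0 up mul] xe xf.
rewrite -cylinder_mul; [|exact: sub..].
apply: cylinder_neq0; first exact/sub/mul.
by move=> ef0; apply: n0; rewrite -ef0; exact: mul.
Qed.

(** An element [(alpha, A)] with [alpha] shorter than the word can only test the
source of the next edge [g]: the filter contains some element with word
[rcons alpha g], which is either below [(alpha, A)] or disjoint from it. *)
Lemma filter_next xi w alpha A (g : edge G) :
    is_filter xi -> has_word xi w -> ES (Some (alpha, A)) ->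
    beginning (rcons alpha g) w ->
  xi (Some (alpha, A)) <-> A (edge_source g).
Proof.
move=> Fxi xw ESA /xw[B xB]; split=> [xA|Ag].
  have [y [[ay Ay] [gy _]]] := filter_meet Fxi xA xB.
  by rewrite -(vertex_at_beginning gy).
case/is_filterP: Fxi => sub ne n0 up mul; apply: (up _ _ xB ESA) => y [gy _].
split; first exact: beginning_prefix (prefix_rcons _ _) gy.
by rewrite (vertex_at_beginning gy).
Qed.

(** By [filter_next], the word decides membership of every element that stops
before its end, so only the level at a finite word remains to be compared. *)
Lemma filter_word_inj xi eta w :
    is_filter xi -> is_filter eta -> has_word xi w -> has_word eta w ->
    (forall alpha, w = Fin alpha -> level xi alpha = level eta alpha) ->
  xi = eta.
Proof.
wlog suff H : xi eta / is_filter xi -> is_filter eta -> has_word xi w ->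
    has_word eta w ->
    (forall alpha, w = Fin alpha -> level xi alpha = level eta alpha) ->
    xi `<=` eta.
  move=> Fx Fe wx we l; apply/seteqP; split; apply: H => // a aw.
  by rewrite l.
move=> Fx Fe xw ew lev; have [sub _ n0 _ _] := Fx.
move=> [[a A]|] xA; last by case: n0.
have ESA := sub _ xA.
have /beginning_next[wa|[g ga]] : beginning a w by apply/xw; exists A.
  have : level eta a A by rewrite -lev//; case: ESA => _ _ [].
  by case.
by apply/(filter_next Fe ew ESA ga)/(filter_next Fx xw ESA ga).
Qed.

Lemma has_word_inj xi w w' : has_word xi w -> has_word xi w' -> w = w'.
Proof.
move=> xw xw'; apply: beginning_inj => u.
by split=> [/xw/xw'|/xw'/xw].
Qed.

Lemma is_path_cat alpha (g : edge G) gamma :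
  is_path (alpha ++ g :: gamma) =
  [&& is_path alpha, edge_source g \in path_range alpha & is_path (g :: gamma)].
Proof.
case: alpha => [|a alpha] /=; first by rewrite in_setT.
by rewrite /is_path /= cat_path.
Qed.

Lemma is_path_rcons alpha (g : edge G) :
  is_path (rcons alpha g) = is_path alpha && (edge_source g \in path_range alpha).
Proof. by rewrite -cats1 is_path_cat /= !andbT. Qed.

Lemma path_range_rcons alpha (g : edge G) :
  path_range (rcons alpha g) = edge_range g.
Proof. by rewrite -cats1 path_range_cat. Qed.

Lemma is_inf_pathP (p : nat -> edge G) :
  is_inf_path p <-> forall n, is_path (mkseq p n).
Proof.
split=> [pp|pp n].
  elim=> // n IH; rewrite mkseqS is_path_rcons IH /=; case: n {IH} => [|n].
    by rewrite in_setT.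
  by rewrite mkseqS path_range_rcons; apply/mem_set/pp.
have := pp n.+2; rewrite !mkseqS is_path_rcons path_range_rcons.
by move=> /andP[_ /set_mem].
Qed.

Lemma Yset_beginning y u : Yset y -> beginning u (ypath_word y) ->
  is_path u /\ path_range u (vertex_at y (size u)).
Proof.
move=> Yy uy; case: (beginning_next uy) => [yu|[g]].
  case: y Yy yu {uy} => [//|alpha v] [pa sv rv] [<-]; split=> //.
  by rewrite vertex_at_end.
move=> gy; rewrite (vertex_at_beginning gy).
suff: is_path (rcons u g) by rewrite is_path_rcons => /andP[-> /set_mem].
case: y Yy gy {uy} => [p /is_inf_pathP pp /= ->//|alpha v [pa _ _]] /= /prefixP[s ea].
by move: pa; rewrite ea /is_path => /cat_sorted2[].
Qed.

(** The point of the tight spectrum that corresponds to a boundary path. *)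
Definition boundary_filter y : set triple := [set e | ES e /\ cylinder e y].

Lemma boundary_filter_beginning y u : Yset y -> beginning u (ypath_word y) ->
  boundary_filter y (Some (u, [set vertex_at y (size u)])).
Proof.
move=> Yy uy; have [pu ru] := Yset_beginning Yy uy.
split; last by [].
split=> //; first by exists (vertex_at y (size u)).
by split; [exact: B_family1|move=> v ->].
Qed.

Lemma boundary_filter_filter y : Yset y -> is_filter (boundary_filter y).
Proof.
move=> Yy; apply/is_filterP; split.
- by move=> e [].
- exists (Some ([::], [set vertex_at y 0])); apply: boundary_filter_beginning => //.
  by case: y {Yy} => //= ? ?; exact: prefix0s.
- by case.
- by move=> e f [ESe ey] ESf ef; split=> //; exact: ef.
- move=> e f [ESe ey] [ESf fy]; split; first exact: ES_mulP.
  by rewrite cylinder_mul.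
Qed.

Lemma boundary_filter_word y : Yset y -> has_word (boundary_filter y) (ypath_word y).
Proof.
move=> Yy u; split=> [[A [_ []]]//|uy]; eexists; exact: boundary_filter_beginning.
Qed.

Lemma boundary_filter_level alpha v :
  level (boundary_filter (YFin alpha v)) alpha = [set A | ES (Some (alpha, A)) /\ A v].
Proof.
apply/predeqP => A; rewrite /level /boundary_filter /cylinder /mkset vertex_at_end.
split=> [[_ [? []]]//|[ESA Av]]; split; first by case: ESA => _ _ [].
by split=> //; split=> //; exact: prefix_refl.
Qed.

(** Any element [(b, B)] compatible with all of [boundary_filter y] already
contains [y]: past the end of a finite [y], the final vertex would have to emit
an edge. *)
Lemma boundary_filter_ultra y : Yset y -> is_ultrafilter (boundary_filter y).
Proof.
move=> Yy; split; first exact: boundary_filter_filter.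
move=> eta Fe sub; apply/seteqP; split=> // -[[b B]|] eB; last by case: Fe.
have ESB : ES (Some (b, B)) by case: Fe => + _ _ _ _; exact.
split=> //.
have meet u : beginning u (ypath_word y) -> exists z,
    [/\ beginning b (ypath_word z), B (vertex_at z (size b)),
        beginning u (ypath_word z) &
        vertex_at z (size u) = vertex_at y (size u)].
  move=> uy; have eu := sub _ (boundary_filter_beginning Yy uy).
  by have [z [[bz Bz] [uz vz]]] := filter_meet Fe eB eu; exists z.
case: (pselect (beginning b (ypath_word y))) => [bY|nb].
  by have [z [bz Bz _ vz]] := meet _ bY; split=> //; rewrite -vz.
exfalso; case: y Yy nb meet {sub} => [p|u v] Yy nb meet.
  have [z [bz _ uz _]] := meet (mkseq p (size b)) (beginning_mkseq _ _).
  apply: nb => /=; have := beginning_total bz uz.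
  case=> /prefixP[s eb]; have := congr1 size eb; rewrite size_cat size_mkseq.
    rewrite -{1}[size b]addn0 => /eqP; rewrite eqn_add2l eq_sym => /nilP s0.
    by rewrite eb s0 cats0.
  rewrite -{1}[size b]addn0 => /eqP; rewrite eqn_add2l eq_sym => /nilP s0.
  by rewrite {1}eb s0 cats0.
have [z [bz _ uz]] := meet u (prefix_refl _); rewrite vertex_at_end => vz.
case: (beginning_total bz uz) => [//|/prefixP[[|g s] eb]].
  by apply: nb; rewrite eb cats0; exact: prefix_refl.
case: Yy => _ sv _; apply: (sv g); rewrite -vz (@vertex_at_beginning _ u g)//.
by apply: beginning_prefix bz; rewrite eb -cat_rcons prefix_prefix.
Qed.

(** If [e] met every element of [xi], the elements above some product of [e]
with an element of [xi] would form a larger filter. *)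
Lemma ultrafilter_disjoint xi e : is_ultrafilter xi -> ES e -> ~ xi e ->
  exists2 f, xi f & cylinder f `&` cylinder e = set0.
Proof.
move=> [Fxi max] ESe; apply: contra_notP => nd.
have [sub ne n0 up mul] := (is_filterP xi).1 Fxi.
pose eta := [set q | ES q /\
  exists2 f, xi f & cylinder f `&` cylinder e `<=` cylinder q].
have [f0 xf0] := ne.
have ESs f : xi f -> ES f by exact: sub.
rewrite -(max eta).
- by split=> //; exists f0 => // y [].
- apply/is_filterP; split.
  + by move=> q [].
  + by exists e; split=> //; exists f0 => // y [].
  + move=> [_ [f xf fe0]]; apply: nd; exists f => //.
    by apply/seteqP; split=> // y /fe0.
  + move=> p q [ESp [f xf fp]] ESq pq; split=> //; exists f => // y /fp.
    exact: pq.
  + move=> p q [ESp [f xf fp]] [ESq [g xg gq]]; split; first exact: ES_mulP.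
    exists (ES_mul f g); first exact: mul.
    rewrite !cylinder_mul//; [|exact: ESs..] => y [[fy gy] ey].
    by split; [exact: fp|exact: gq].
- by move=> f xf; split; [exact: sub|exists f => // y []].
Qed.

(** Follow edges until the range of one of them contains a sink, and stop at
that sink; if this never happens, the path goes on forever. *)
Lemma boundary_path_from v : exists2 y, Yset y & vertex_at y 0 = v.
Proof.
case: (pselect (sink v)) => [sv|/existsNP[g /contrapT <-{v}]].
  by exists (YFin [::] v).
(* The successor [b] is arbitrary when the range of [a] contains a sink. *)
have next (a : edge G) : exists b, (forall v, edge_range a v -> ~ sink v) ->
    edge_range a (edge_source b).
  case: (pselect (exists b, edge_range a (edge_source b))) => [[b ab]|nb].
    by exists b.
  have [v av] := edge_range_neq0 a; exists a => /(_ v av)/existsNP[b /contrapT bv].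
  by exfalso; apply: nb; exists b; rewrite bv.
pose F a := projT1 (cid (next a)).
have FP a : (forall v, edge_range a v -> ~ sink v) ->
    edge_range a (edge_source (F a)) := projT2 (cid (next a)).
pose p n := iter n F g.
case: (pselect (exists n, exists2 v, edge_range (p n) v & sink v)) => [sk|nsk].
  have : exists n, `[< exists2 v, edge_range (p n) v & sink v >].
    by case: sk => n sn; exists n; exact/asboolP.
  move=> /ex_minnP[n /asboolP[v nv sv] nmin].
  have pp m : m <= n -> is_path (mkseq p m.+1).
    elim: m => // m IH mn; rewrite mkseqS is_path_rcons IH ?(ltnW mn)// andTb.
    rewrite mkseqS path_range_rcons; apply/mem_set/FP => v' mv' sv'.
    suff : n <= m by rewrite leqNgt mn.
    by apply: nmin; apply/asboolP; exists v'.
  exists (YFin (mkseq p n.+1) v); last by [].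
  by split=> //; [exact: pp|rewrite mkseqS path_range_rcons].
exists (YInf p) => // n; apply: FP => v nv sv; apply: nsk.
by exists n, v.
Qed.

Definition cat_ypath alpha y : ypath G :=
  match y with
  | YInf p => YInf (cat_inf alpha p)
  | YFin beta v => YFin (alpha ++ beta) v
  end.

Lemma mkseq_cat_inf alpha (p : nat -> edge G) n :
  mkseq (cat_inf alpha p) (size alpha + n) = alpha ++ mkseq p n.
Proof.
rewrite /mkseq iotaD map_cat add0n; congr (_ ++ _).
  apply: (@eq_from_nth _ (p 0)); rewrite ?size_map ?size_iota// => i ia.
  rewrite (nth_map 0) ?size_iota// nth_iota// add0n /cat_inf.
  exact: set_nth_default.
rewrite -[X in iota X]addn0 iotaDl -map_comp; apply: eq_map => i /=.
by rewrite /cat_inf addKn nth_default// leq_addr.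
Qed.

Lemma beginning_cat alpha y : beginning alpha (ypath_word (cat_ypath alpha y)).
Proof.
case: y => [p|u v] /=; last exact: prefix_prefix.
by rewrite -[X in mkseq _ X]addn0 mkseq_cat_inf cats0.
Qed.

Lemma vertex_at_cat alpha y n :
  vertex_at (cat_ypath alpha y) (size alpha + n) = vertex_at y n.
Proof.
case: y => [p|u v] /=.
  by rewrite /cat_inf addKn nth_default// leq_addr.
by rewrite map_cat nth_cat size_map ltnNge leq_addr /= addKn.
Qed.

Lemma Yset_catP alpha y : Yset (cat_ypath alpha y) <->
  [/\ is_path alpha, path_range alpha (vertex_at y 0) & Yset y].
Proof.
split=> [Yay|].
  have [pa ra] := Yset_beginning Yay (beginning_cat _ _).
  rewrite -[size alpha]addn0 vertex_at_cat in ra; split=> //.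
  case: y Yay ra => [p /is_inf_pathP pp _|u v [pu sv rv] _] /=.
    apply/is_inf_pathP => -[//|n]; have := pp (size alpha + n.+1).
    by rewrite mkseq_cat_inf is_path_cat => /and3P[].
  case: u pu rv => [|g u] //; rewrite is_path_cat path_range_cat//.
  by move=> /and3P[].
case: y => [p|u v] [pa ra] /=.
  move=> /is_inf_pathP pp; apply/is_inf_pathP => n.
  have : is_path (mkseq (cat_inf alpha p) (size alpha + n.+1)).
    by rewrite mkseq_cat_inf is_path_cat pa (mem_set ra); exact: (pp n.+1).
  suff /prefixP[s ->] : prefix (mkseq (cat_inf alpha p) n)
      (mkseq (cat_inf alpha p) (size alpha + n.+1)).
    by rewrite /is_path => /cat_sorted2[].
  by rewrite addnC addSnnS /mkseq iotaD map_cat prefix_prefix.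
case: u ra => [|g u] ra [pu sv rv]; first by rewrite cats0; split.
split=> //; last by rewrite path_range_cat.
by rewrite is_path_cat pa pu (mem_set ra).
Qed.

Lemma Yset_cylinder_neq0 e : ES e -> e <> None ->
  exists2 y, Yset y & cylinder e y.
Proof.
case: e => [[a A]|//] [pa [v Av] [BA sA]] _.
have [y Yy yv] := boundary_path_from v.
exists (cat_ypath a y).
  by apply/Yset_catP; split=> //; rewrite yv; exact: sA.
split; first exact: beginning_cat.
by rewrite -[size a]addn0 vertex_at_cat yv.
Qed.

End Filters.

(** * Pointwise convergence, compactness and local constancy *)

Section Topology.

Lemma initial_nbhsP (S : choiceType) (T : topologicalType) (f : S -> T)
    (x : initial_topology f) (A : set S) :
  nbhs x A <-> exists2 B, nbhs (f x) B & f @^-1` B `<=` A.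
Proof.
split=> [[_ [[B oB <-] Bx BA]]|[B nB BA]].
  by exists B => //; exact: open_nbhs_nbhs.
by apply: filterS BA _; exact: (@initial_continuous _ _ f x).
Qed.

(** Agreement with [xi] on finite sets of elements generates a filter that
converges to [xi] in every coordinate, hence is finer than the neighbourhoods. *)
Lemma set_ptws_nbhsP (T : eqType) (xi : set_ptws T) (N : set (set T)) :
  nbhs xi N <->
  exists s : seq T, [set eta : set T | {in s, forall e, eta e <-> xi e}] `<=` N.
Proof.
pose ev (A : set T) : {ptws T -> bool} := fun x => x \in A.
pose agree (s : seq T) := [set g : {ptws T -> bool} | {in s, g =1 ev xi}].
pose F : set_system {ptws T -> bool} := filter_from setT agree.
have FF : Filter F.
  apply: filter_fromT_filter; first by exists [::].
  move=> s t; exists (s ++ t) => g gst.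
  by split=> e es; apply: gst; rewrite mem_cat es ?orbT.
have Fcvg : F --> ev xi.
  apply/cvg_sup => i A /initial_nbhsP[B nB BA]; exists [:: i] => // g gi.
  by apply: BA; rewrite /= gi ?mem_head//; exact: nbhs_singleton.
have agreeE s (eta : set T) : agree s (ev eta) <->
    {in s, forall e, eta e <-> xi e}.
  split=> H e /H; rewrite /ev => E.
    by split=> /mem_set; [rewrite E|rewrite -E] => /set_mem.
  by apply/idP/idP => /set_mem/E/mem_set.
split=> [/initial_nbhsP[B /Fcvg[s _ sB] BN]|[s sN]].
  by exists s => eta /agreeE/sB/BN.
apply/initial_nbhsP; exists (agree s); last by move=> eta /agreeE/sN.
elim: s {sN agreeE} => [|e s IH]; first by apply: filterS filterT => g _ e.
have ne : nbhs (ev xi : {ptws T -> bool}) [set g | g e = ev xi e].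
  apply: (@proj_continuous T (fun=> bool) e (ev xi) [set b | b = ev xi e]).
  by [].
apply: filterS (filterI ne IH) => g [ge gs] x.
by rewrite inE => /orP[/eqP->//|]; exact: gs.
Qed.

(** Compactness as an induction principle on sets: the families of the sets that
contain a given set with property [P] generate a filter, to which the near
covering form of compactness applies. *)
Lemma compact_ideal_cover (T : topologicalType) (K : set T)
    (P : set T -> Prop) :
    compact K -> P set0 -> (forall M N, P M -> P N -> P (M `|` N)) ->
    (forall x, K x -> exists2 N, nbhs x N & P N) ->
  exists2 N, P N & K `<=` N.
Proof.
move=> /compact_near_coveringP cK P0 PU Ploc.
pose F : set_system (set T) := filter_from P (fun N => [set M | N `<=` M]).
have FF : Filter F.
  apply: filter_from_filter; first by exists set0.
  move=> M N PM PN; exists (M `|` N); first exact: PU.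
  by move=> L ML; split; apply: subset_trans ML => x; [left|right].
have [x Kx|N PN NK] := cK _ F (fun M x => M x) FF.
  have [N nN PN] := Ploc x Kx.
  exists (N, [set M | N `<=` M]); first by split=> //; exists N.
  by move=> [y M] [/= Ny NM]; exact: NM.
by exists N => //; apply: NK => x.
Qed.

Section LocallyConstant.
Context (R : comPzRingType).
Implicit Types Z : topologicalType.

Lemma locally_constant_open Z (f : Z -> R) (D : set R) :
  (forall z, \forall w \near z, f w = f z) -> open (f @^-1` D).
Proof.
by move=> lf; rewrite openE => z Dz; apply: filterS (lf z) => w /= ->.
Qed.

Lemma locally_constant_closed Z (f : Z -> R) (D : set R) :
  (forall z, \forall w \near z, f w = f z) -> closed (f @^-1` D).
Proof.
move=> lf; rewrite -[_ @^-1` _]setCK; apply: open_closedC.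
exact: (@locally_constant_open Z f (~` D)).
Qed.

(** The support of a locally constant function is already closed, so that
compactness of its closure can be tested inside any compact set. *)
Lemma LcP Z (f : Z -> R) : Lc R Z f <->
  (forall z, \forall w \near z, f w = f z) /\
  exists2 K, compact K & [set z | f z != 0%R] `<=` K.
Proof.
split=> -[lf].
  move=> cf; split=> //; exists (closure [set z | f z != 0%R]) => //.
  exact: subset_closure.
have clf : closed [set z | f z != 0%R].
  exact: (@locally_constant_closed Z f [set r | r != 0%R]).
move=> [K cK fK]; split=> //; rewrite -(closure_id _).1//.
exact: subclosed_compact clf cK fK.
Qed.

(** Extension by zero creates no jump along a subset [U] that is both open and
closed, and the closed support of a function vanishing off [U] stays inside
[U], so that its compactness does not depend on the ambient space. *)
Lemma Lc_ext0P Z (U : set Z) (f : Z -> R) : clopen U ->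
  Lc_ext0 R Z U f <-> Lc R Z f /\ (forall z, ~ U z -> f z = 0%R).
Proof.
move=> [oU cU]; split=> [[/LcP[lf [K cK fK]] f0]|[/LcP[lf [K cK fK]] f0]].
  split=> //; apply/LcP; split.
    move=> z; case: (pselect (U z)) => [Uz|nUz].
      have /initial_nbhsP[B nB BS] := lf (exist _ z (mem_set Uz)).
      have nU : nbhs z U by exact: open_nbhs_nbhs.
      apply: filterS (filterI nB nU) => w [Bw Uw].
      exact: (BS (exist _ w (mem_set Uw))).
    have nU : nbhs z (~` U) by apply: open_nbhs_nbhs; split=> //; exact: closed_openC.
    by apply: filterS nU => w nw; rewrite !f0.
  exists (set_val @` K).
    apply: continuous_compact => //; apply: continuous_subspaceT.
    exact: initial_continuous.
  move=> z fz; have Uz : U z.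
    by apply: contrapT => /f0 E; move: fz; rewrite /= E eqxx.
  by exists (exist _ z (mem_set Uz)) => //; exact: fK.
split=> //; apply/LcP; split.
  move=> z; apply/initial_nbhsP; exists [set w | f w = f (set_val z)] => //.
  exact: lf.
have [_ cf] : Lc R Z f by apply/LcP; split=> //; exists K.
exists (set_val @^-1` [set z | f z != 0%R]) => //.
have clf : closed [set z | f z != 0%R].
  exact: (@locally_constant_closed Z f [set r | r != 0%R]).
rewrite -((closure_id _).1 clf) in cf.
move=> F FF FS; have [] := cf (set_val @ F) _.
  by apply: filterS FS => z.
move=> p [fp clp]; have Up : U p.
  by apply: contrapT => /f0 E; move: fp; rewrite /= E eqxx.
exists (exist _ p (mem_set Up)); split=> // A B FA /initial_nbhsP[C nC CB].
have [|_ [[z Az <-] Cz]] := clp (@set_val _ U @` A) C _ nC.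
  exact: (@filterS _ F _ A _ (@preimage_image _ _ set_val A) FA).
by exists z; split=> //; exact: CB.
Qed.

End LocallyConstant.
End Topology.

(** * The topology of the tight spectrum *)

Section TightSpace.
Context (G : ultragraph).
Local Notation triple := (option (seq (edge G) * set (vertex G))).
Implicit Types (e f p : triple) (s : seq triple) (xi eta : tight_space G).
Local Notation is_filter := (is_pfilter (@ES G) (@ES_le G) None).
Local Notation is_ultrafilter := (is_pultrafilter (@ES G) (@ES_le G) None).

Lemma filter_nbhsP (xi : filter_space G) (N : set (filter_space G)) :
  nbhs xi N <-> exists s, [set eta : filter_space G |
    {in s, forall e, set_val eta e <-> set_val xi e}] `<=` N.
Proof.
rewrite initial_nbhsP; split=> [[B /set_ptws_nbhsP[s sB] BN]|[s sN]].
  by exists s => eta /sB/BN.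
exists [set eta : set triple | {in s, forall e, eta e <-> set_val xi e}] => //.
by apply/set_ptws_nbhsP; exists s.
Qed.

Lemma tight_nbhsP xi (N : set (tight_space G)) :
  nbhs xi N <-> exists s, [set eta |
    {in s, forall e, filter_of eta e <-> filter_of xi e}] `<=` N.
Proof.
rewrite initial_nbhsP; split=> [[B /filter_nbhsP[s sB] BN]|[s sN]].
  by exists s => eta /sB/BN.
exists [set eta : filter_space G |
  {in s, forall e, set_val eta e <-> filter_of xi e}] => //.
by apply/filter_nbhsP; exists s.
Qed.

Lemma filter_of_filter xi : is_filter (filter_of xi).
Proof. exact: (set_valP (set_val xi : filter_space G)). Qed.

Lemma filter_of_inj : injective (@filter_of G).
Proof. by move=> xi eta /val_inj/val_inj. Qed.

Lemma tightP (xi : filter_space G) : @tight G xi <-> forall s,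
  exists2 eta, is_ultrafilter eta & {in s, forall e, eta e <-> set_val xi e}.
Proof.
split=> [txi s|H N /filter_nbhsP[s sN]].
  have [|eta [ueta es]] := txi [set eta : filter_space G |
      {in s, forall e, set_val eta e <-> set_val xi e}].
    by apply/filter_nbhsP; exists s.
  by exists (set_val eta).
have [eta ueta es] := H s.
have Feta : ES_filters (eta : set_ptws triple) by case: ueta.
pose x : filter_space G := exist _ (eta : set_ptws triple) (mem_set Feta).
by exists x; split=> //; exact: sN.
Qed.

Lemma tight_exists (xi : set triple) : is_filter xi ->
    (forall s, exists2 eta, is_ultrafilter eta &
       {in s, forall e, eta e <-> xi e}) ->
  exists eta, filter_of eta = xi.
Proof.
move=> Fxi H.
pose x : filter_space G := exist _ (xi : set_ptws triple) (mem_set Fxi).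
have tx : @tight G x by apply/tightP.
pose z : tight_space G := exist _ x (mem_set tx).
by exists z.
Qed.

Lemma V_elt_clopen e : clopen (V_elt e).
Proof.
split.
  rewrite openE => xi xe; apply/tight_nbhsP; exists [:: e] => eta /(_ e).
  by rewrite mem_head => /(_ isT)[_]; exact.
rewrite -[V_elt e]setCK; apply: open_closedC; rewrite openE => xi xe.
apply/tight_nbhsP; exists [:: e] => eta /(_ e).
by rewrite mem_head => /(_ isT)[H _] /H.
Qed.

(** The limit of an ultrafilter [F] of tight filters is the set of the [p]
such that [F] contains [V_elt p]. All filter conditions are closed, except
nonemptiness, which holds since [e] belongs to the limit; and tightness passes
to limits by definition. *)
Lemma V_elt_compact e : compact (V_elt e).
Proof.
rewrite compact_ultra => F FU Fe.
pose L : set triple := [set p | F (V_elt p)].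
have FL : is_filter L.
  have sub p : L p -> ES p.
    move=> /filter_ex[xi xp]; case: (filter_of_filter xi) => + _ _ _ _; exact.
  apply/is_filterP; split=> //.
  - by exists e.
  - by move=> /filter_ex[xi]; case: (filter_of_filter xi).
  - move=> p q Lp ESq pq; apply: filterS Lp => xi.
    by have /is_filterP[_ _ _ up _] := filter_of_filter xi => xp; exact: up pq.
  - move=> p q Lp Lq; apply: filterS (filterI Lp Lq) => xi [].
    by have /is_filterP[_ _ _ _ mul] := filter_of_filter xi; exact: mul.
have FLs s : F [set xi | {in s, forall p, filter_of xi p <-> L p}].
  elim: s => [|p s IH]; first by apply: filterS filterT.
  have Fp : F [set xi | filter_of xi p <-> L p].
    case: (in_ultra_setVsetC (V_elt p) FU) => Fp.
      by apply: filterS (Fp) => xi xp; split.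
    apply: filterS (Fp) => xi xp; split=> // Lp.
    by have [eta []] := filter_ex (filterI Fp Lp).
  apply: filterS (filterI Fp IH) => xi [xp xs] q.
  by rewrite inE => /orP[/eqP->//|]; exact: xs.
have [xi xiL] : exists xi, filter_of xi = L.
  apply: tight_exists => // s; have [xi xs] := filter_ex (FLs s).
  have /tightP/(_ s)[eta ueta es] := set_valP xi.
  by exists eta => // p ps; exact: iff_trans (es p ps) (xs p ps).
exists xi; split; first by rewrite /V_elt /= xiL.
by move=> N /tight_nbhsP[s]; rewrite xiL => /filterS; apply.
Qed.

(** On finitely many elements, an ultrafilter looks like any boundary path in a
suitable cylinder, since each element that it misses is disjoint from one that
it contains. *)
Lemma ultrafilter_agree (eta : set triple) s : is_ultrafilter eta ->
  exists2 f, eta f & forall y, cylinder f y ->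
    {in s, forall e, boundary_filter y e <-> eta e}.
Proof.
move=> ueta; have /is_filterP[sub [f0 ef0] n0 up mul] := ueta.1.
elim: s => [|e s [f ef fs]]; first by exists f0.
suff [g eg ge] : exists2 g, eta g & forall y, cylinder g y ->
    (boundary_filter y e <-> eta e).
  exists (ES_mul f g); first exact: mul.
  move=> y; rewrite cylinder_mul; [|exact: sub..] => -[fy gy] p.
  by rewrite inE => /orP[/eqP->|]; [exact: ge|exact: fs].
case: (pselect (eta e)) => [ee|ne].
  by exists e => // y ey; split=> // _; split=> //; exact: sub.
case: (pselect (ES e)) => [ESe|nESe].
  have [g eg ge] := ultrafilter_disjoint ueta ESe ne.
  exists g => // y gy; split=> // -[_ ey].
  by have : (cylinder g `&` cylinder e) y; [split|rewrite ge].
by exists f0 => // y _; split=> // -[].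
Qed.

Lemma boundary_point_subproof (y : Y G) :
  exists xi, filter_of xi = boundary_filter (set_val y).
Proof.
have Yy : Yset (set_val y) := set_valP y.
apply: tight_exists; first exact: boundary_filter_filter.
by move=> s; exists (boundary_filter (set_val y)) => //; exact: boundary_filter_ultra.
Qed.

Definition boundary_point (y : Y G) : tight_space G :=
  projT1 (cid (boundary_point_subproof y)).

Lemma boundary_pointE y : filter_of (boundary_point y) = boundary_filter (set_val y).
Proof. exact: (projT2 (cid (boundary_point_subproof y))). Qed.

Lemma boundary_point_V_elt e y : ES e -> V_elt e (boundary_point y) <-> Y_elt e y.
Proof.
move=> ESe; rewrite /V_elt /= boundary_pointE Y_eltE.
by split=> [[]|ey]; last split.
Qed.

(** A neighbourhood of a tight filter contains an ultrafilter agreeing with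
it on finitely many elements, and [ultrafilter_agree] replaces the ultrafilter
by a boundary path. *)
Lemma boundary_point_dense xi (N : set (tight_space G)) :
  nbhs xi N -> exists y, N (boundary_point y).
Proof.
move=> /tight_nbhsP[s sN].
have /tightP/(_ s)[eta ueta es] := set_valP xi.
have [f ef fs] := ultrafilter_agree s ueta.
have ESf : ES f by case: ueta => -[+ _ _ _ _] _; exact.
have [y Yy fy] : exists2 y, Yset y & cylinder f y.
  apply: Yset_cylinder_neq0 => // f0.
  by case: ueta => -[_ _ + _ _] _; rewrite -f0.
pose z : Y G := exist _ y (mem_set Yy); exists z; apply: sN => e e_s.
rewrite boundary_pointE; exact: iff_trans (fs y fy e e_s) (es e e_s).
Qed.

End TightSpace.

Local Open Scope ring_scope.

(** * Linear spans *)

Section LinearSpan.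
Context (R : comPzRingType) (X : Type).
Implicit Types (S : set (X -> R)) (f g : X -> R) (A B : set X).

Lemma lin_span_ind S (Q : (X -> R) -> Prop) :
    Q (fun=> 0) -> (forall f g, Q f -> Q g -> Q (f \+ g)) ->
    (forall c g, S g -> Q (c \*o g)) ->
  forall f, lin_span S f -> Q f.
Proof.
move=> Q0 QD QZ f [n [c [g [Sg ->]]]].
elim: n c g Sg => [|n IH] c g Sg.
  suff -> : (fun x => \sum_(i < 0) c i * g i x) = fun=> 0 by [].
  by apply/funext => x; rewrite big_ord0.
pose w (i : 'I_n) := widen_ord (leqnSn n) i.
have -> : (fun x => \sum_(i < n.+1) c i * g i x) =
    (fun x => \sum_(i < n) (c \o w) i * (g \o w) i x) \+
    (c ord_max \*o g ord_max).
  by apply/funext => x; rewrite big_ord_recr.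
by apply: QD; [apply: IH => i; exact: Sg|exact: QZ].
Qed.

Lemma lin_span0 S : lin_span S (fun=> 0).
Proof.
exists 0%N, (fun=> 0), (fun _ _ => 0); split=> [[]//|].
by apply/funext => x; rewrite big_ord0.
Qed.

Lemma lin_spanD S f g : lin_span S f -> lin_span S g -> lin_span S (f \+ g).
Proof.
move=> [m [c [u [Su ->]]]] [n [d [v [Sv ->]]]].
exists (m + n)%N,
  (fun i => match fintype.split i with inl j => c j | inr j => d j end),
  (fun i => match fintype.split i with inl j => u j | inr j => v j end).
split=> [i|]; first by case: fintype.split.
apply/funext => x; rewrite big_split_ord /=; congr (_ + _); apply: eq_bigr => i _.
  by rewrite (unsplitK (inl i)).
by rewrite (unsplitK (inr i)).
Qed.

Lemma lin_spanZ S c f : lin_span S f -> lin_span S (c \*o f).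
Proof.
move=> [n [d [g [Sg ->]]]]; exists n, (fun i => c * d i), g; split=> //.
apply/funext => x /=; rewrite mulr_sumr.
by apply: eq_bigr => i _; rewrite mulrA.
Qed.

Lemma lin_span_mem S f : S f -> lin_span S f.
Proof.
move=> Sf; exists 1%N, (fun=> 1), (fun=> f); split=> //.
by apply/funext => x; rewrite big_ord1 mul1r.
Qed.

Lemma lin_spanM S :
    (forall f g, S f -> S g -> lin_span S (f \* g)) ->
  forall f g, lin_span S f -> lin_span S g -> lin_span S (f \* g).
Proof.
move=> SM f g + Sg; apply: (@lin_span_ind S (fun f => lin_span S (f \* g))).
- suff -> : (fun=> 0) \* g = fun=> 0 by exact: lin_span0.
  by apply/funext => x /=; rewrite mul0r.
- move=> u v Su Sv; suff -> : (u \+ v) \* g = (u \* g) \+ (v \* g).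
    exact: lin_spanD.
  by apply/funext => x /=; rewrite mulrDl.
move=> c u Su; suff -> : (c \*o u) \* g = c \*o (u \* g).
  apply: lin_spanZ; move: Sg.
  apply: (@lin_span_ind S (fun g => lin_span S (u \* g))).
  - suff -> : u \* (fun=> 0) = fun=> 0 by exact: lin_span0.
    by apply/funext => x /=; rewrite mulr0.
  - move=> v w Sv Sw; suff -> : u \* (v \+ w) = (u \* v) \+ (u \* w).
      exact: lin_spanD.
    by apply/funext => x /=; rewrite mulrDr.
  move=> d v Sv; suff -> : u \* (d \*o v) = d \*o (u \* v).
    by apply: lin_spanZ; exact: SM.
  by apply/funext => x /=; rewrite mulrCA.
by apply/funext => x /=; rewrite mulrA.
Qed.

Lemma indicI_mul A B : \1_(A `&` B) = \1_A \* \1_B :> (X -> R).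
Proof.
apply/funext => x; rewrite /indic /= in_setI.
by do 2!case: (_ \in _); rewrite ?mulr0 ?mulr1.
Qed.

Lemma indicU_add A B :
  \1_(A `|` B) = \1_A \+ (\1_B \+ (-1 \*o \1_(A `&` B))) :> (X -> R).
Proof.
apply/funext => x; rewrite /indic /= in_setU in_setI.
by do 2!case: (_ \in _); rewrite /= ?mulr0 ?mulr1 ?addr0 ?add0r ?subrr ?addr0.
Qed.

Lemma indicD_add A B : \1_(A `\` B) = \1_A \+ (-1 \*o \1_(A `&` B)) :> (X -> R).
Proof.
apply/funext => x; rewrite /indic /= in_setD in_setI.
by do 2!case: (_ \in _); rewrite /= ?mulr0 ?mulr1 ?addr0 ?add0r ?subrr ?addr0.
Qed.

Lemma indic_mul_id A f : (forall x, ~ A x -> f x = 0) -> \1_A \* f = f.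
Proof.
move=> f0; apply/funext => x; rewrite /indic /=.
case: (boolP (x \in A)) => [_|/negP xA]; first by rewrite mul1r.
by rewrite f0 ?mulr0// => /mem_set.
Qed.

End LinearSpan.

Lemma lin_span_comp (R : comPzRingType) (X Z : Type) (j : X -> Z)
    (S : set (Z -> R)) :
  (fun f => f \o j) @` lin_span S = lin_span [set f \o j | f in S].
Proof.
apply/seteqP; split=> [_ [f + <-]|].
  apply: (@lin_span_ind _ _ S (fun f => lin_span _ (f \o j))).
  - exact: lin_span0.
  - by move=> f1 g1; exact: lin_spanD.
  by move=> c g Sg; apply: (@lin_spanZ _ _ _ c (g \o j)); apply: lin_span_mem;
    exists g.
apply: lin_span_ind.
- by exists (fun=> 0) => //; exact: lin_span0.
- by move=> _ _ [f Sf <-] [g Sg <-]; exists (f \+ g) => //; exact: lin_spanD.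
- move=> c _ [g Sg <-]; exists (c \*o g) => //.
  by apply: lin_spanZ; exact: lin_span_mem.
Qed.

(** * Locally constant functions on the tight spectrum *)

Section LocallyConstantAlgebra.
Context (R : comPzRingType) (Z : topologicalType).
Implicit Types (f g : Z -> R).

Lemma Lc0 : Lc R Z (fun=> 0).
Proof.
apply/LcP; split=> [z|]; first exact: nearW.
by exists set0; [exact: compact0|move=> z /=; rewrite eqxx].
Qed.

Lemma LcD f g : Lc R Z f -> Lc R Z g -> Lc R Z (f \+ g).
Proof.
move=> /LcP[lf [K cK fK]] /LcP[lg [L cL gL]]; apply/LcP; split.
  by move=> z; apply: filterS (filterI (lf z) (lg z)) => w [/= -> ->].
exists (K `|` L); first exact: compactU.
move=> z /=; case: (eqVneq (f z) 0) => [->|fz _]; last by left; exact: fK.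
by rewrite add0r => gz; right; exact: gL.
Qed.

Lemma LcM f g : (forall z, \forall w \near z, f w = f z) -> Lc R Z g ->
  Lc R Z (f \* g).
Proof.
move=> lf /LcP[lg [K cK gK]]; apply/LcP; split.
  by move=> z; apply: filterS (filterI (lf z) (lg z)) => w [/= -> ->].
exists K => // z /=; case: (eqVneq (g z) 0) => [->|gz _]; last exact: gK.
by rewrite mulr0 eqxx.
Qed.

Lemma LcZ c f : Lc R Z f -> Lc R Z (c \*o f).
Proof. by apply: (@LcM (fun=> c)) => z; exact: nearW. Qed.

Lemma indic_locally_constant (A : set Z) : clopen A ->
  forall z, \forall w \near z, \1_A w = \1_A z :> R.
Proof.
move=> [oA cA] z; rewrite /indic; case: (boolP (z \in A)) => zA.
  have nA : nbhs z A by apply: open_nbhs_nbhs; split=> //; exact: set_mem.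
  by apply: filterS nA => w /mem_set ->.
have nA : nbhs z (~` A).
  apply: open_nbhs_nbhs; split; first exact: closed_openC.
  by move=> /mem_set; apply/negP.
by apply: filterS nA => w nw; rewrite memNset.
Qed.

End LocallyConstantAlgebra.

Section LcTight.
Context (G : ultragraph) (R : comPzRingType).
Local Notation triple := (option (seq (edge G) * set (vertex G))).
Local Notation T := (tight_space G).
Local Notation V_indic := [set \1_(V_elt e) | e in @ES G].

Lemma V_eltI (e f : triple) : ES e -> ES f ->
  V_elt (ES_mul e f) = V_elt e `&` V_elt f.
Proof.
move=> ESe ESf; apply/predeqP => xi.
have /is_filterP[_ _ _ up mul] := filter_of_filter xi.
split=> [ef|[xe xf]]; last exact: mul.
by split; apply: (up _ _ ef) => //; rewrite cylinder_mul// => y [].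
Qed.

Lemma V_indic_span (e : triple) : lin_span V_indic (\1_(V_elt e) : T -> R).
Proof.
apply: lin_span_mem; case: (pselect (ES e)) => [ESe|nESe]; first by exists e.
exists None => //; congr indic; apply/predeqP => xi.
have /is_filterP[sub _ n0 _ _] := filter_of_filter xi.
by split=> [/n0//|/sub].
Qed.

Lemma V_indic_spanM (f g : T -> R) :
  lin_span V_indic f -> lin_span V_indic g -> lin_span V_indic (f \* g).
Proof.
apply: lin_spanM => _ _ [e ESe <-] [e' ESe' <-].
by rewrite -indicI_mul -V_eltI//; exact: V_indic_span.
Qed.

(** Intersecting with [V_elt e] or removing it keeps an indicator in the span,
since the span is closed under products. *)
Lemma agree_span (M : set T) (xi : T) (s : seq triple) :
  lin_span V_indic (\1_M : T -> R) ->
  lin_span V_indic (\1_(M `&` [set eta | {in s, forall e,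
    filter_of eta e <-> filter_of xi e}]) : T -> R).
Proof.
elim: s M => [|e s IH] M SM; first by rewrite (_ : _ `&` _ = M)//; apply/setIidPl.
have -> : M `&` [set eta | {in e :: s, forall e,
      filter_of eta e <-> filter_of xi e}] =
    (M `&` [set eta | filter_of eta e <-> filter_of xi e]) `&`
    [set eta | {in s, forall e, filter_of eta e <-> filter_of xi e}].
  apply/predeqP => eta; split=> [[Me es]|[[Me ee] es]]; split=> //.
  - by split=> //; apply: es; rewrite mem_head.
  - by move=> p ps; apply: es; rewrite inE ps orbT.
  - by move=> p; rewrite inE => /orP[/eqP->//|]; exact: es.
apply: IH; have SMe : lin_span V_indic (\1_(M `&` V_elt e) : T -> R).
  by rewrite indicI_mul; apply: V_indic_spanM => //; exact: V_indic_span.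
case: (pselect (filter_of xi e)) => xe.
  rewrite (_ : _ `&` _ = M `&` V_elt e)//.
  by apply/predeqP => eta; split=> -[Me ee]; split=> //; apply/ee.
rewrite (_ : _ `&` _ = M `\` V_elt e); last first.
  apply/predeqP => eta; split=> -[Me ee]; split=> //; first by move=> /ee.
by rewrite indicD_add; apply: lin_spanD => //; exact: lin_spanZ.
Qed.

(** Around a point of its support, a locally constant function is constant on
a basic neighbourhood whose indicator lies in the span. The sets [N] for which
the indicator of [N] and its product with the function lie in the span are
stable under finite unions, so that one of them covers the support. *)
Lemma Lc_tightE : Lc R T = lin_span V_indic.
Proof.
apply/seteqP; split=> [f /LcP[lf [K cK fK]]|f].
  pose P (N : set T) := lin_span V_indic (\1_N : T -> R) /\
                        lin_span V_indic (f \* \1_N).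
  have [||x Kx|N [_ fN] KN] := compact_ideal_cover cK (P := P).
  - split; [rewrite (_ : \1_set0 = fun=> 0)|rewrite (_ : _ \* _ = fun=> 0)];
      try exact: lin_span0; apply/funext => x; rewrite /= indic0//.
    by rewrite mulr0.
  - move=> M N [SM fM] [SN fN]; have SMN := V_indic_spanM SM SN.
    split.
      rewrite indicU_add indicI_mul; apply: lin_spanD => //.
      by apply: lin_spanD => //; exact: lin_spanZ.
    have -> : f \* \1_(M `|` N) =
        (f \* \1_M) \+ ((f \* \1_N) \+ (-1 \*o ((f \* \1_M) \* \1_N))).
      apply/funext => x; rewrite indicU_add indicI_mul /=.
      by rewrite !mulrDr mulrCA [f x * (_ * _)]mulrA.
    apply: lin_spanD => //; apply: lin_spanD => //; apply: lin_spanZ.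
    exact: V_indic_spanM.
  - have [s sx] := (tight_nbhsP x _).1 (lf x).
    have [_ [e0 xe0] _ _ _] := filter_of_filter x.
    (* Intersect with some [V_elt e0], as constants need not lie in the span. *)
    pose N := V_elt e0 `&` [set eta | {in s, forall e,
      filter_of eta e <-> filter_of x e}].
    exists N.
      apply: filterI; last by apply/tight_nbhsP; exists s.
      by apply: open_nbhs_nbhs; split=> //; case: (V_elt_clopen e0).
    have SN : lin_span V_indic (\1_N : T -> R).
      by apply: agree_span; exact: V_indic_span.
    split=> //; suff -> : f \* \1_N = f x \*o \1_N by exact: lin_spanZ.
    apply/funext => z; rewrite /indic /=; case: (boolP (z \in N)) => [zN|_].
      by congr (_ * _); apply: sx; case: (set_mem zN).
    by rewrite !mulr0.
  suff -> : f = f \* \1_N by [].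
  rewrite -[LHS](@indic_mul_id _ _ N f).
    by apply/funext => x; rewrite /= mulrC.
  by move=> x nNx; apply: contra_notP nNx => /eqP fx; exact/KN/fK.
apply: lin_span_ind.
- exact: Lc0.
- exact: LcD.
- move=> c _ [e ESe <-]; apply: LcZ; apply/LcP; split.
    exact/indic_locally_constant/V_elt_clopen.
  exists (V_elt e); first exact: V_elt_compact.
  by move=> x; rewrite /indic /=; case: (boolP (x \in V_elt e)) => [/set_mem//|]; rewrite eqxx.
Qed.

End LcTight.

(** * The two partial actions on boundary paths *)

Section Equivariance.
Context (G : ultragraph).
Implicit Types (alpha beta gamma : seq (edge G)) (t : free_group (edge G)).
Implicit Types (x : ypath G) (y z : Y G).

Lemma reduced_form_inj t alpha beta alpha' beta' :
  reduced_form t alpha beta -> reduced_form t alpha' beta' ->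
  alpha = alpha' /\ beta = beta'.
Proof.
rewrite /reduced_form => -> E.
have pos u v : [seq a.2 | a : bool * edge G <- [seq (true, e) | e <- u] ++
    [seq (false, e) | e <- rev v] & a.1] = u.
  rewrite filter_cat map_cat.
  have -> : [seq a <- [seq (true, e) | e <- u] | a.1] = [seq (true, e) | e <- u].
    by rewrite filter_map /= filter_predT.
  rewrite filter_map /= filter_pred0 /= cats0 -map_comp map_id_in//.
have neg u v : [seq a.2 | a : bool * edge G <- [seq (true, e) | e <- u] ++
    [seq (false, e) | e <- rev v] & ~~ a.1] = rev v.
  rewrite filter_cat map_cat [X in _ ++ [seq _ | _ <- X]]filter_map /= filter_predT.
  by rewrite filter_map /= filter_pred0 /= -map_comp map_id_in.
split; first by rewrite -(pos alpha beta) E pos.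
by apply: (can_inj revK); rewrite -(neg alpha beta) E neg.
Qed.

Lemma admissible_inj t alpha beta alpha' beta' :
  admissible t alpha beta -> admissible t alpha' beta' ->
  alpha = alpha' /\ beta = beta'.
Proof. by move=> [_ + _ _ _] [_ + _ _ _]; exact: reduced_form_inj. Qed.

Lemma admissible_inv t alpha beta :
  admissible t alpha beta -> admissible t^-1%g beta alpha.
Proof.
move=> [t1 ta pa pb ab]; split=> //; last by rewrite setIC.
  by rewrite invg_eq1.
rewrite /reduced_form /= /word_inv ta map_cat rev_cat -!map_comp -map_rev revK.
by rewrite -map_rev.
Qed.

Lemma cat_inf_inj alpha : injective (@cat_inf (edge G) alpha).
Proof.
move=> p q /funeqP pq; apply/funext => n; have := pq (size alpha + n)%N.
by rewrite /cat_inf addKn !nth_default// leq_addr.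
Qed.

Lemma cat_ypath_inj alpha : injective (@cat_ypath G alpha).
Proof.
move=> [p|u v] [q|u' v'] //= [].
  by move/cat_inf_inj => ->.
by move=> /eqP; rewrite eqseq_cat// eqxx /= => /eqP -> ->.
Qed.

Lemma beginningP alpha x :
  beginning alpha (ypath_word x) -> exists x', x = cat_ypath alpha x'.
Proof.
case: x => [p|u v] /=; last by move=> /prefixP[s ->]; exists (YFin s v).
move=> ap; exists (YInf (fun n => p (size alpha + n)%N)) => /=; congr YInf.
apply/funext => n; rewrite /cat_inf; case: (ltnP n (size alpha)) => na.
  have := congr1 (fun s => nth (p n) s n) ap; rewrite nth_mkseq// => <-.
  exact: set_nth_default.
by rewrite nth_default// subnKC.
Qed.

Lemma h_graphP t y z : h_graph t y z <-> (t = 1%g /\ z = y) \/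
  exists alpha beta x, [/\ admissible t alpha beta,
    set_val y = cat_ypath beta x & set_val z = cat_ypath alpha x].
Proof.
split=> -[[]|]; try by left.
  move=> [a [b [adm [[p [yp zp]]|[u [v [yu zu]]]]]]]; right.
    by exists a, b, (YInf p).
  by exists a, b, (YFin u v).
move=> [a [b [[p|u v] [adm yx zx]]]]; right; exists a, b; split=> //.
  by left; exists p.
by right; exists u, v.
Qed.

Lemma h_graph_fun t y z z' : h_graph t y z -> h_graph t y z' -> z = z'.
Proof.
move=> /h_graphP[[t1 ->]|[a [b [x [adm yx zx]]]]].
  by move=> /h_graphP[[_ ->//]|[a [b [x [[/eqP]]]]]].
move=> /h_graphP[[t1 _]|[a' [b' [x' [adm' yx' zx']]]]].
  by case: adm => /eqP.
have [ea eb] := admissible_inj adm adm'; subst a' b'.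
apply: val_inj; rewrite /= [LHS]zx [RHS]zx'; congr cat_ypath.
by apply: (@cat_ypath_inj b); rewrite -yx.
Qed.

(** The two ranges intersect in an element of [B_family] because the words of a
nontrivial group element are not both empty. The zero of the semilattice takes
care of the group elements that act nowhere. *)
Lemma V_dom_Y_dom t : (V_dom t = setT /\ Y_dom t = setT) \/
  exists2 e, ES e & V_dom t = V_elt e /\ Y_dom t = Y_elt e.
Proof.
case: (pselect (t = 1%g)) => [t1|t1].
  by left; split; apply/seteqP; split=> // x _; left.
right; case: (pselect (exists a b, admissible t a b)) => [[a [b adm]]|nadm].
  exists (Some (a, path_range a `&` path_range b)).
    case: adm => _ tab pa pb ab; split=> //; split; last by move=> v [].
    case: a tab pa ab => [|g a] tab pa ab.
      rewrite setTI; case: b tab pb ab => [|h b] tab pb ab.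
        by case: t1; apply: val_inj; rewrite /= tab.
      exact/B_G0/G0_range.
    case: b tab pb ab => [|h b] tab pb ab; last exact/B_G0/G0_setI/G0_range/G0_range.
    by rewrite setIT; exact/B_G0/G0_range.
  split; apply/seteqP; split=> x.
  - move=> [//|[a' [b' [adm' H]]]].
    by have [-> ->] := admissible_inj adm adm'.
  - by move=> H; right; exists a, b.
  - move=> [//|[a' [b' [adm' H]]]].
    by have [-> ->] := admissible_inj adm adm'.
  - by move=> H; right; exists a, b.
exists None => //; split; apply/seteqP; split=> x //.
- by move=> [//|[a [b [adm _]]]]; case: nadm; exists a, b.
- by move=> x0; have /is_filterP[_ _ n0 _ _] := filter_of_filter x.
- by move=> [//|[a [b [adm _]]]]; case: nadm; exists a, b.
Qed.

Lemma V_dom_clopen t : clopen (@V_dom G t).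
Proof.
have [[-> _]|[e _ [-> _]]] := V_dom_Y_dom t; first exact: clopenT.
exact: V_elt_clopen.
Qed.

Lemma boundary_point_V_dom t y : V_dom t (boundary_point y) <-> Y_dom t y.
Proof.
have [[-> ->]//|[e ESe [-> ->]]] := V_dom_Y_dom t.
exact: boundary_point_V_elt.
Qed.

Lemma h_graph_total t y : Y_dom t y -> exists z, h_graph t^-1%g y z.
Proof.
move=> [->|[a [b [adm /Y_eltE]]]].
  by exists y; left; rewrite invg1.
have Yy : Yset (set_val y) := set_valP y.
move=> [/beginningP[x yx]]; rewrite yx -[size a]addn0 vertex_at_cat => -[_ bx].
have Yz : Yset (cat_ypath b x).
  apply/Yset_catP; split=> //; first by case: adm.
  by move: Yy; rewrite yx => /Yset_catP[].
pose z : Y G := exist (fun w => w \in @Yset G) _ (mem_set Yz).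
exists z; apply/h_graphP; right; exists b, a, x; split=> //.
exact: admissible_inv.
Qed.

Lemma boundary_point_word y :
  has_word (filter_of (boundary_point y)) (ypath_word (set_val y)).
Proof.
by rewrite boundary_pointE; apply: boundary_filter_word; exact: set_valP.
Qed.

(** The range of a path depends on its last edge only, which lies in [gamma]. *)
Lemma boundary_level alpha beta gamma v y z :
    set_val y = YFin (beta ++ gamma) v -> set_val z = YFin (alpha ++ gamma) v ->
    gamma != [::] ->
  level (filter_of (boundary_point z)) (alpha ++ gamma) =
  level (filter_of (boundary_point y)) (beta ++ gamma).
Proof.
move=> yv zv g0; rewrite !boundary_pointE yv zv !boundary_filter_level.
have [py pz] : is_path (beta ++ gamma) /\ is_path (alpha ++ gamma).
  have := set_valP z; have := set_valP y.
  by rewrite /= [\val y]yv [\val z]zv => -[? _ _] [].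
apply/predeqP => A; rewrite /= /B_at /= !path_range_cat//.
by split=> -[[? ? ?] ?].
Qed.

(** The level of [y] at [beta] has a smallest element, the singleton of the final
vertex [v], and [v] lies in the range of [alpha] too. *)
Lemma boundary_level_end alpha beta v y z :
    set_val y = YFin beta v -> set_val z = YFin alpha v ->
  level (filter_of (boundary_point z)) alpha =
  [set A `&` path_range alpha | A in [set A | B_family A /\
     exists2 C, level (filter_of (boundary_point y)) beta C & C `<=` A]].
Proof.
move=> yv zv; rewrite !boundary_pointE yv zv !boundary_filter_level.
have Yy : Yset (set_val y) := set_valP y.
have Yz : Yset (set_val z) := set_valP z.
rewrite yv in Yy; rewrite zv in Yz.
case: Yy => pb sv bv; case: Yz => pa _ av.
apply/predeqP => A; split=> [[[_ _ [BA Aa]] Av]|[A' [BA' [C [_ Cv] CA]] <-]].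
  exists A; last exact/setIidPl.
  split=> //; exists [set v]; last by move=> w ->.
  by split=> //; split=> //; [exists v|split=> [|w ->//]; exact: B_family1].
split; last by split=> //; exact: CA.
split=> //; first by exists v; split=> //; exact: CA.
split; last by move=> w [].
case: alpha {zv pa av} => [|g a]; first by rewrite setIT.
by apply: B_setI => //; exact/B_G0/G0_range.
Qed.

Lemma phi_graph_boundary t y z : h_graph t y z ->
  phi_graph t (boundary_point y) (boundary_point z).
Proof.
move=> /h_graphP[[-> ->]|[a [b [x [adm yx zx]]]]]; first by left.
right; exists a, b; split=> // /=.
have wy := boundary_point_word y; have wz := boundary_point_word z.
rewrite yx in wy; rewrite zx in wz.
case: x yx zx wy wz => [p|[|g u] v] /= yx zx wy wz.
- by constructor 1; exists p.
- rewrite !cats0 in yx zx wy wz; constructor 3; split=> //.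
  exact: boundary_level_end yx zx.
- constructor 2; exists (g :: u); split=> //.
  exact: boundary_level yx zx _.
Qed.

(** The three cases in the definition of the graph correspond to different
words of the argument, so that the word of the image is determined; its level at
a finite word is prescribed as well. *)
Lemma phi_graph_boundary_fun t y z (eta : tight_space G) : h_graph t y z ->
  phi_graph t (boundary_point y) eta -> eta = boundary_point z.
Proof.
move=> hyz; have := phi_graph_boundary hyz.
move: hyz => /h_graphP[[t1 ->]|[a [b [x [adm yx zx]]]]].
  by move=> _ [[_ ->//]|[a [b [[/eqP]]]]].
move=> [[t1 _]|[a' [b' [adm' H]]]]; first by case: adm => /eqP.
have [ea eb] := admissible_inj adm adm'; subst a' b' => {adm'}.
move=> [[t1 _]|[a' [b' [adm' H']]]]; first by case: adm => /eqP.
have [ea eb] := admissible_inj adm adm'; subst a' b' => {adm'}.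
apply: filter_of_inj; have Fe := filter_of_filter eta.
have Fz := filter_of_filter (boundary_point z).
case: H => [[p [wy wz]]|[u [u0 wy wz lz]]|[wy wz lz]];
  case: H' => [[p' [wy' we]]|[u' [u0' wy' we le]]|[wy' we le]];
  have := has_word_inj wy wy' => //.
- move=> [/cat_inf_inj E]; subst p'.
  exact: filter_word_inj Fe Fz we wz _.
- move=> [/eqP]; rewrite eqseq_cat// eqxx /= => /eqP E; subst u'.
  by apply: filter_word_inj Fe Fz we wz _ => _ [<-]; rewrite le lz.
- move=> [/(congr1 size)/eqP]; rewrite size_cat -{2}[size b]addn0 eqn_add2l.
  by move=> /eqP u00; rewrite u00 in u0.
- move=> [/(congr1 size)/eqP]; rewrite size_cat -{1}[size b]addn0 eqn_add2l.
  by move=> /eqP u00; rewrite -u00 in u0'.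
- move=> _; by apply: filter_word_inj Fe Fz we wz _ => _ [<-]; rewrite le lz.
Qed.

Lemma phi_map_boundary t y : Y_dom t y ->
  phi_map t^-1%g (boundary_point y) = boundary_point (h_map t^-1%g y).
Proof.
move=> /h_graph_total[z hz].
have -> : h_map t^-1%g y = z.
  by apply: xget_unique => // z' /h_graph_fun; exact.
apply: xget_unique; first exact: phi_graph_boundary.
by move=> eta; exact: phi_graph_boundary_fun.
Qed.

End Equivariance.

(** * Restriction to boundary paths *)

Section Restriction.
Context (G : ultragraph) (R : comPzRingType).
Implicit Types (t : free_group (edge G)).
Local Notation T := (tight_space G).

Definition boundary_restriction (f : T -> R) : Y G -> R :=
  f \o @boundary_point G.
Local Notation psi := boundary_restriction.

Lemma boundary_restriction_V_elt e : ES e ->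
  psi \1_(V_elt e) = \1_(Y_elt e).
Proof.
move=> ESe; apply/funext => y; rewrite /psi /indic /=; congr (_ %:R).
by congr nat_of_bool; apply/idP/idP => /set_mem/(boundary_point_V_elt y ESe)/mem_set.
Qed.

Lemma boundary_restriction_V_dom t : psi \1_(V_dom t) = \1_(Y_dom t).
Proof.
apply/funext => y; rewrite /psi /indic /=; congr (_ %:R).
by congr nat_of_bool; apply/idP/idP => /set_mem/boundary_point_V_dom/mem_set.
Qed.

(** Two locally constant functions that differ at a point differ on a
neighbourhood of it, which contains a boundary path. *)
Lemma boundary_restriction_inj : {in Lc R T &, injective psi}.
Proof.
move=> f g /set_mem[lf _] /set_mem[lg _] /funeqP fg; apply/funext => xi.
have [y [<- <-]] := boundary_point_dense (filterI (lf xi) (lg xi)).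
exact: fg.
Qed.

Lemma boundary_restriction_Lc : psi @` Lc R T = @D_alg G R.
Proof.
rewrite Lc_tightE lin_span_comp /D_alg; congr lin_span.
apply/seteqP; split=> [_ [_ [e ESe <-] <-]|_ [e ESe <-]].
  by exists e => //; rewrite -boundary_restriction_V_elt.
exists \1_(V_elt e); first by exists e.
exact: boundary_restriction_V_elt.
Qed.

Lemma boundary_restriction_ideal t :
  psi @` Lc_ext0 R T (V_dom t) = @D_ideal G R t.
Proof.
have cV := V_dom_clopen t.
apply/seteqP; split=> [_ [f /(Lc_ext0P _ cV)[Lf f0] <-]|].
  rewrite -(indic_mul_id f0); move: Lf; rewrite Lc_tightE.
  apply: (@lin_span_ind _ _ _ (fun f => D_ideal t (psi (\1_(V_dom t) \* f)))).
  - rewrite (_ : psi _ = fun=> 0); first exact: lin_span0.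
    by apply/funext => y; rewrite /psi /= mulr0.
  - move=> u v Du Dv; rewrite (_ : psi _ =
      psi (\1_(V_dom t) \* u) \+ psi (\1_(V_dom t) \* v)).
      exact: lin_spanD.
    by apply/funext => y; rewrite /psi /= mulrDr.
  move=> c _ [e ESe <-].
  rewrite (_ : psi _ = c \*o (\1_(Y_dom t) \* \1_(Y_elt e))).
    by apply: lin_spanZ; apply: lin_span_mem; exists e.
  rewrite -boundary_restriction_V_dom -boundary_restriction_V_elt//.
  by apply/funext => y; rewrite /psi /= mulrCA.
apply: lin_span_ind.
- exists (fun=> 0) => //; apply/(Lc_ext0P _ cV); split=> //; exact: Lc0.
- move=> _ _ [f /(Lc_ext0P _ cV)[Lf f0] <-] [g /(Lc_ext0P _ cV)[Lg g0] <-].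
  exists (f \+ g) => //; apply/(Lc_ext0P _ cV); split; first exact: LcD.
  by move=> x nx /=; rewrite f0// g0// addr0.
move=> c _ [e ESe <-]; exists (c \*o (\1_(V_dom t) \* \1_(V_elt e))).
  apply/(Lc_ext0P _ cV); split.
    apply: LcZ; apply: LcM; first exact: indic_locally_constant.
    by rewrite Lc_tightE; exact: V_indic_span.
  by move=> x nx /=; rewrite /indic memNset// mul0r mulr0.
by rewrite -boundary_restriction_V_dom -boundary_restriction_V_elt.
Qed.

Lemma boundary_restriction_equivariant t (f : T -> R) :
  psi (pullback (Delta G) t f) =
  pullback (PartialAction (@Y_dom G) (@h_map G)) t (psi f).
Proof.
apply/funext => y; rewrite /psi /pullback /=.
case: (boolP (y \in Y_dom t)) => [/set_mem yt|nyt].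
  by rewrite mem_set ?phi_map_boundary//; exact/boundary_point_V_dom.
rewrite memNset// => /boundary_point_V_dom/mem_set yt.
by rewrite yt in nyt.
Qed.

End Restriction.

Theorem theorem4p16 (G : ultragraph) (R : comPzRingType) :
  apa_equivalent (Theta G R) (dual_partial_action R (Delta G)).
Proof.
exists (@boundary_restriction G R); split.
  split=> //; split.
  - by move=> f Lf; rewrite /= -boundary_restriction_Lc; exists f.
  - exact: boundary_restriction_inj.
  - by rewrite /= -boundary_restriction_Lc.
move=> t; split; first exact: boundary_restriction_ideal.
by move=> f _; exact: boundary_restriction_equivariant.
Qed.
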